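(* There are just two orbits of generic 3-forms in $\wedge^3(\mathbb{R}^7)^*$ under the action of $\mathrm{GL}_7(\mathbb{R})$. A pair of representatives (one for each orbit) are $$\Omega_0=-2\big(E_0^*\wedge E_1^*\wedge F_1^*+E_0^*\wedge E_2^*\wedge F_2^*+E_0^*\wedge E_3^*\wedge F_3^*\big)-4\,E_1^*\wedge E_2^*\wedge E_3^*+4\,F_1^*\wedge F_2^*\wedge F_3^*$$ and $$\Omega_1=e^{147}+e^{257}+e^{367}+e^{123}-e^{156}+e^{246}-e^{345}.$$
   Context: $\{E_0,E_1,E_2,E_3,F_1,F_2,F_3\}$ denotes the canonical basis of $\mathbb{R}^7$ (in this order) and $\{E_0^*,\dots,F_3^*\}$ its dual basis. For a basis $\{e_i^*\}_{i=1}^7$ of $(\mathbb{R}^7)^*$, $e^{ijk}:=e_i^*\wedge e_j^*\wedge e_k^*$. The group $\mathrm{GL}_7(\mathbb{R})$ acts on $\wedge^3(\mathbb{R}^7)^*$ by $(f\cdot\Omega)(X,Y,Z)=\Omega(f^{-1}(X),f^{-1}(Y),f^{-1}(Z))$. A 3-form $\Omega$ is called generic when its orbit under this action is open in $\wedge^3(\mathbb{R}^7)^*$ (equivalently, the stabilizer $G_\Omega=\{f:f\cdot\Omega=\Omega\}$ has dimension $49-35=14$). *)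

(* Defs.v *)
From HB Require Import structures.
From mathcomp Require Import all_boot all_order all_algebra.
From mathcomp Require Import all_classical all_reals all_analysis.

Set Implicit Arguments.
Unset Strict Implicit.
Unset Printing Implicit Defensive.

Import Order.TTheory GRing.Theory Num.Theory.
Import numFieldNormedType.Exports.

Local Open Scope classical_set_scope.
Local Open Scope ring_scope.

Notation vec7 R := 'cV[R]_7.

Notation covec7 R := 'Hom('cV[R]_7, R^o).

(* The ambient function space carries the topology of pointwise convergence.
   On the finite-dimensional space [form3] of 3-forms, the subspace topology
   it induces is the usual vector space topology. *)
Notation tensor3 R := {ptws (vec7 R * vec7 R * vec7 R)%type -> R}.

Definition trilinear (R : realType) (w : tensor3 R) : Prop :=
  [/\ forall Y Z, scalar (fun X : vec7 R => w (X, Y, Z)),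
      forall X Z, scalar (fun Y : vec7 R => w (X, Y, Z)) &
      forall X Y, scalar (fun Z : vec7 R => w (X, Y, Z))].

Definition alternating (R : realType) (w : tensor3 R) : Prop :=
  forall X Y : vec7 R, [/\ w (X, X, Y) = 0, w (X, Y, X) = 0 & w (Y, X, X) = 0].

Definition form3 (R : realType) : set (tensor3 R) :=
  [set w | trilinear w /\ alternating w].

Definition GL7 (R : realType) : set 'M[R]_7 := [set f | f \in unitmx].

Definition act (R : realType) (f : 'M[R]_7) (w : tensor3 R) : tensor3 R :=
  fun v => let: (X, Y, Z) := v in
    w (invmx f *m X, invmx f *m Y, invmx f *m Z).

Definition orbit3 (R : realType) (w : tensor3 R) : set (tensor3 R) :=
  [set act f w | f in @GL7 R].

(* Openness is relative to [form3]; the topology of [subspace A] is the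
   induced one on A, its points outside A being isolated, and the orbit of a
   3-form consists of 3-forms. *)
Definition generic (R : realType) (w : tensor3 R) : Prop :=
  form3 w /\ open (orbit3 w : set (subspace (@form3 R))).

(* Normalized by (a /\ b /\ c)(X, Y, Z) = det, without the factor 1/3!. *)
Definition wedge3 (R : realType) (a b c : covec7 R) : tensor3 R :=
  fun v => let: (X, Y, Z) := v in
    \det (\matrix_(i < 3, j < 3)
            ([:: a; b; c]`_i : covec7 R) ([:: X; Y; Z]`_j)).

Definition coord7 (R : realType) (i : 'I_7) : covec7 R :=
  linfun (fun X : vec7 R => X i 0 : R^o).

(* The canonical basis is ordered E_0, E_1, E_2, E_3, F_1, F_2, F_3; hence
   dualE k is E_k^* for k <= 3, and dualF k is F_k^* for 1 <= k <= 3. *)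
Definition dualE (R : realType) (k : nat) : covec7 R := coord7 R (inord k).
Definition dualF (R : realType) (k : nat) : covec7 R := coord7 R (inord (3 + k)%N).

Lemma coord7E (R : realType) (i : 'I_7) (X : vec7 R) : coord7 R i X = X i 0.
Proof.
have lin : linear (fun X : vec7 R => X i 0 : R^o).
  by move=> a u v; rewrite !mxE.
pose l := GRing.isLinear.Build R (vec7 R) R^o _ _ lin.
pose g : {linear vec7 R -> R^o} := HB.pack (fun X : vec7 R => X i 0 : R^o) l.
exact: (lfunE g X).
Qed.

Definition Omega0 (R : realType) : tensor3 R :=
  fun v =>
    - 2 * (wedge3 (dualE R 0) (dualE R 1) (dualF R 1) v
           + wedge3 (dualE R 0) (dualE R 2) (dualF R 2) v
           + wedge3 (dualE R 0) (dualE R 3) (dualF R 3) v)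
    - 4 * wedge3 (dualE R 1) (dualE R 2) (dualE R 3) v
    + 4 * wedge3 (dualF R 1) (dualF R 2) (dualF R 3) v.
Arguments Omega0 : clear implicits.

(* e^{ijk}, with 1-based indices. *)
Definition basis_wedge (R : realType) (e : 7.-tuple (covec7 R))
    (i j k : nat) : tensor3 R :=
  wedge3 e`_i.-1 e`_j.-1 e`_k.-1.

Definition Omega1 (R : realType) (e : 7.-tuple (covec7 R)) : tensor3 R :=
  fun v =>
    basis_wedge e 1 4 7 v + basis_wedge e 2 5 7 v + basis_wedge e 3 6 7 v
    + basis_wedge e 1 2 3 v - basis_wedge e 1 5 6 v + basis_wedge e 2 4 6 v
    - basis_wedge e 3 4 5 v.

(* Main.v *)
(* A 3-form w on R^7 = <e_0, x_1, x_2, x_3, y_1, y_2, y_3> is brought, by explicit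
   changes of basis whose entries are rational in the coefficients of w, to a
   form supported on the seven lines of a Fano plane: a symplectic reduction of
   i(e_0) w is followed by a normalization, under Sp_6, of the remaining
   3-form. The only divisors are coefficients on the lines themselves. Inside an
   open orbit each of them can be made nonzero by a small perturbation, so every
   open orbit contains a form with seven nonzero Fano coefficients; rescaling,
   permuting the points and splitting the 3-form on the x_i, y_i into two
   decomposable ones identifies it with Omega_0 or Omega_1, according to the
   signs of the coefficients. Near a Fano form w0 the same algorithm is
   continuous and fixes w0, so it ends in the sign class of w0: hence the
   two orbits are open. They differ because X, Y |-> w(X, Y, .) vanishes on some
   independent pair for Omega_0, but not for Omega_1. *)

Require Import Defs.
From mathcomp Require Import all_boot all_order all_algebra.
From mathcomp Require Import all_classical all_reals all_analysis.
From mathcomp Require Import ring lra.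

Import Order.TTheory GRing.Theory Num.Theory.
Import numFieldNormedType.Exports.

Local Open Scope classical_set_scope.
Local Open Scope ring_scope.

Set Implicit Arguments.
Unset Strict Implicit.
Unset Printing Implicit Defensive.

(** * Trilinear alternating forms and changes of basis *)

Section Multilinear.
Variables (R : realType) (w : tensor3 R).
Hypothesis Fw : form3 w.
Implicit Types X Y Z : vec7 R.

Lemma trilinD1 X X' Y Z : w (X + X', Y, Z) = w (X, Y, Z) + w (X', Y, Z).
Proof. by case: Fw => -[h _ _] _; have := h Y Z 1 X X'; rewrite scale1r mul1r. Qed.

Lemma trilinD2 X Y Y' Z : w (X, Y + Y', Z) = w (X, Y, Z) + w (X, Y', Z).
Proof. by case: Fw => -[_ h _] _; have := h X Z 1 Y Y'; rewrite scale1r mul1r. Qed.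

Lemma trilinD3 X Y Z Z' : w (X, Y, Z + Z') = w (X, Y, Z) + w (X, Y, Z').
Proof. by case: Fw => -[_ _ h] _; have := h X Y 1 Z Z'; rewrite scale1r mul1r. Qed.

Lemma trilin01 Y Z : w (0, Y, Z) = 0.
Proof. by apply: (addrI (w (0, Y, Z))); rewrite -trilinD1 !addr0. Qed.

Lemma trilin02 X Z : w (X, 0, Z) = 0.
Proof. by apply: (addrI (w (X, 0, Z))); rewrite -trilinD2 !addr0. Qed.

Lemma trilin03 X Y : w (X, Y, 0) = 0.
Proof. by apply: (addrI (w (X, Y, 0))); rewrite -trilinD3 !addr0. Qed.

Lemma trilinZ1 s X Y Z : w (s *: X, Y, Z) = s * w (X, Y, Z).
Proof.
by case: Fw => -[h _ _] _; have := h Y Z s X 0; rewrite !addr0 trilin01 addr0.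
Qed.

Lemma trilinZ2 s X Y Z : w (X, s *: Y, Z) = s * w (X, Y, Z).
Proof.
by case: Fw => -[_ h _] _; have := h X Z s Y 0; rewrite !addr0 trilin02 addr0.
Qed.

Lemma trilinZ3 s X Y Z : w (X, Y, s *: Z) = s * w (X, Y, Z).
Proof.
by case: Fw => -[_ _ h] _; have := h X Y s Z 0; rewrite !addr0 trilin03 addr0.
Qed.

Lemma alt12 X Y : w (X, X, Y) = 0. Proof. by case: Fw => _ /(_ X Y) []. Qed.
Lemma alt13 X Y : w (X, Y, X) = 0. Proof. by case: Fw => _ /(_ X Y) []. Qed.
Lemma alt23 X Y : w (Y, X, X) = 0. Proof. by case: Fw => _ /(_ X Y) []. Qed.

Lemma swap12 X Y Z : w (Y, X, Z) = - w (X, Y, Z).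
Proof.
have := alt12 (X + Y) Z; rewrite trilinD1 !trilinD2 !alt12 => h.
by apply/eqP; rewrite -addr_eq0; apply/eqP; rewrite -[RHS]h; ring.
Qed.

Lemma swap23 X Y Z : w (X, Z, Y) = - w (X, Y, Z).
Proof.
have := alt23 (Y + Z) X; rewrite trilinD2 !trilinD3 !alt23 => h.
by apply/eqP; rewrite -addr_eq0; apply/eqP; rewrite -[RHS]h; ring.
Qed.

End Multilinear.

Section Coefficients.
Variable R : realType.
Implicit Types (w : tensor3 R) (X Y Z : vec7 R) (g : 'M[R]_7).

Definition bvec (n : nat) : vec7 R := delta_mx (inord n) 0.

Definition coef w (i j k : nat) : R := w (bvec i, bvec j, bvec k).

Lemma vec7E X : X = \sum_(i < 7) X i 0 *: bvec i.
Proof.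
apply/matrixP => p q; rewrite ord1 summxE (bigD1 p) //= big1 => [|i ip].
  by rewrite !mxE inord_val !eqxx mulr1 addr0.
by rewrite !mxE inord_val (eq_sym p) (negbTE ip) mulr0.
Qed.

Lemma trilin_sum w I (r : seq I) (F G H : I -> vec7 R) : form3 w ->
  w (\sum_(i <- r) F i, \sum_(i <- r) G i, \sum_(i <- r) H i)
  = \sum_(i <- r) \sum_(j <- r) \sum_(k <- r) w (F i, G j, H k).
Proof.
move=> Fw.
rewrite (big_morph (fun X => w (X, _, _)) (id1 := 0) (op1 := +%R)); last 2 first.
- by move=> A B; rewrite trilinD1.
- by rewrite trilin01.
apply: eq_bigr => i _.
rewrite (big_morph (fun X => w (_, X, _)) (id1 := 0) (op1 := +%R)); last 2 first.
- by move=> A B; rewrite trilinD2.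
- by rewrite trilin02.
apply: eq_bigr => j _.
rewrite (big_morph (fun X => w (_, _, X)) (id1 := 0) (op1 := +%R)) //.
- by move=> A B; rewrite trilinD3.
- by rewrite trilin03.
Qed.

Lemma form3_coef w X Y Z : form3 w ->
  w (X, Y, Z) = \sum_(i < 7) \sum_(j < 7) \sum_(k < 7)
                   X i 0 * (Y j 0 * (Z k 0 * coef w i j k)).
Proof.
move=> Fw; rewrite {1}(vec7E X) {1}(vec7E Y) {1}(vec7E Z) trilin_sum //.
apply: eq_bigr => i _; apply: eq_bigr => j _; apply: eq_bigr => k _.
by rewrite trilinZ1 // trilinZ2 // trilinZ3.
Qed.

Lemma coef_swap12 w i j k : form3 w -> coef w j i k = - coef w i j k.
Proof. by move=> Fw; apply: swap12. Qed.
Lemma coef_swap23 w i j k : form3 w -> coef w i k j = - coef w i j k.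
Proof. by move=> Fw; apply: swap23. Qed.
Lemma coef_alt12 w i k : form3 w -> coef w i i k = 0.
Proof. by move=> Fw; apply: alt12. Qed.
Lemma coef_alt23 w i k : form3 w -> coef w k i i = 0.
Proof. by move=> Fw; apply: alt23. Qed.
Lemma coef_alt13 w i k : form3 w -> coef w i k i = 0.
Proof. by move=> Fw; apply: alt13. Qed.

Lemma form_ext w w' : form3 w -> form3 w' ->
  (forall i j k : nat, (i < j)%N -> (j < k)%N -> (k < 7)%N ->
     coef w i j k = coef w' i j k) -> w = w'.
Proof.
move=> Fw Fw' eq_cf; apply/funext => -[[X Y] Z].
rewrite !form3_coef //; apply: eq_bigr => i _; apply: eq_bigr => j _.
apply: eq_bigr => k _; congr (_ * (_ * (_ * _))).
have [ij|ij|->] := ltngtP i j; last by rewrite !coef_alt12.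
- have [jk|jk|->] := ltngtP j k; last by rewrite !coef_alt23.
  + exact: eq_cf.
  + rewrite 2?(@coef_swap23 _ i k j) //; congr (- _).
    have [ik|ik|->] := ltngtP i k; last by rewrite !coef_alt12.
    * exact: eq_cf.
    * by rewrite 2?(@coef_swap12 _ k i j) // eq_cf.
- rewrite 2?(@coef_swap12 _ j i k) //; congr (- _).
  have [ik|ik|->] := ltngtP i k; last by rewrite !coef_alt23.
  + exact: eq_cf.
  + rewrite 2?(@coef_swap23 _ j k i) //; congr (- _).
    have [jk|jk|->] := ltngtP j k; last by rewrite !coef_alt12.
    * exact: eq_cf.
    * by rewrite 2?(@coef_swap12 _ k j i) // eq_cf.
Qed.

(** The action without the inverse: [act f] is [pull (invmx f)], so the classes of [eqv] are the
    orbits. *)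
Definition pull g w : tensor3 R :=
  fun v => let: (X, Y, Z) := v in w (g *m X, g *m Y, g *m Z).

Lemma form3_pull g w : form3 w -> form3 (pull g w).
Proof.
move=> Fw; split; first split=> A B s X Y /=.
- by rewrite mulmxDr -scalemxAr trilinD1 // trilinZ1.
- by rewrite mulmxDr -scalemxAr trilinD2 // trilinZ2.
- by rewrite mulmxDr -scalemxAr trilinD3 // trilinZ3.
- by move=> X Y; rewrite /= alt12 // alt13 // alt23.
Qed.

Definition eqv w w' := exists2 g, g \in unitmx & w' = pull g w.

Lemma eqv_refl w : eqv w w.
Proof.
exists 1%:M; first exact: unitmx1.
by apply/funext => -[[X Y] Z]; rewrite /= !mul1mx.
Qed.

Lemma eqv_sym w w' : eqv w w' -> eqv w' w.
Proof.
case=> g gU ->; exists (invmx g); first by rewrite unitmx_inv.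
by apply/funext => -[[X Y] Z]; rewrite /= !mulKVmx.
Qed.

Lemma eqv_trans w1 w2 w3 : eqv w1 w2 -> eqv w2 w3 -> eqv w1 w3.
Proof.
case=> g gU -> [h hU ->]; exists (g *m h); first by rewrite unitmx_mul gU.
by apply/funext => -[[X Y] Z]; rewrite /= !mulmxA.
Qed.

Lemma eqv_form3 w w' : eqv w w' -> form3 w -> form3 w'.
Proof. by case=> g _ ->; apply: form3_pull. Qed.

Lemma orbit3P w w' : orbit3 w w' <-> eqv w w'.
Proof.
split=> [[f fU <-]|[g gU ->]].
  by exists (invmx f); rewrite ?unitmx_inv //; apply/funext => -[[]].
exists (invmx g); first by rewrite /GL7 /= unitmx_inv.
by apply/funext => -[[X Y] Z]; rewrite /= invmxK.
Qed.

Lemma orbit3_eq w w' : eqv w w' -> orbit3 w = orbit3 w'.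
Proof.
move=> ww'; apply/seteqP; split=> v /orbit3P h; apply/orbit3P.
  exact: eqv_trans (eqv_sym ww') h.
exact: eqv_trans ww' h.
Qed.

(* The infinitesimal action of the elementary matrix [E_ab]; it integrates to
   the action of [1 + s E_ab] because [w] is alternating. *)
Definition elem_act (a b : nat) (s : R) w : tensor3 R :=
  fun v => let: (X, Y, Z) := v in
    w (X, Y, Z) + s * (X (inord b) 0 * w (bvec a, Y, Z)
                       + Y (inord b) 0 * w (X, bvec a, Z)
                       + Z (inord b) 0 * w (X, Y, bvec a)).

Lemma elem_act_pull a b s w : form3 w ->
  elem_act a b s w = pull (1%:M + s *: delta_mx (inord a) (inord b)) w.
Proof.
move=> Fw; apply/funext => -[[X Y] Z] /=.
have E V : (1%:M + s *: delta_mx (inord a) (inord b)) *m V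
         = V + (s * V (inord b) 0) *: bvec a.
  rewrite mulmxDl mul1mx -scalemxAl -scalerA; congr (_ + s *: _).
  apply/matrixP => p q; rewrite !mxE ord1 (bigD1 (inord b)) //= big1.
    by rewrite !mxE !eqxx !andbT addr0 mulrC.
  by move=> i /negPf ib; rewrite !mxE ib andbF mul0r.
rewrite !E !(trilinD1 Fw) !(trilinD2 Fw) !(trilinD3 Fw) !(trilinZ1 Fw).
by rewrite !(trilinZ2 Fw) !(trilinZ3 Fw) !(alt12 Fw) !(alt13 Fw) !(alt23 Fw); ring.
Qed.

Lemma elem_act_eqv a b s w : form3 w -> (a < 7)%N -> (b < 7)%N ->
  (a != b) || (1 + s != 0) -> eqv w (elem_act a b s w).
Proof.
move=> Fw a7 b7 h; rewrite elem_act_pull //; eexists; last by [].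
set A := inord a : 'I_7; set B := inord b : 'I_7.
have /= h' : (A != B) || (1 + s != 0) by rewrite -val_eqE /= !inordK.
(* [1 - t E_ab] is to be the inverse of [1 + s E_ab]. The square of [E_ab] is [E_ab] if a = b,
   whence t = s / (1 + s), and 0 otherwise, whence t = s. *)
pose t := if A == B then (1 + s)^-1 * s else s.
suff /mulmx1_unit [] :
  (1%:M + s *: delta_mx A B) *m (1%:M - t *: delta_mx A B) = 1%:M by [].
have E : delta_mx A B *m delta_mx A B = (A == B)%:R *: delta_mx A B :> 'M[R]_7.
  by rewrite mul_delta_mx_cond eq_sym; case: (_ == _); rewrite ?scale1r ?scale0r.
rewrite mulmxBr mulmx1 mulmxDl mul1mx -scalemxAl -scalemxAr E !scalerA.
rewrite -scalerDl -addrA -scalerBl.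
set u := (X in X *: _); suff -> : u = 0 by rewrite scale0r addr0.
rewrite /u /t; case: eqVneq h' => /= _ h'; last by ring.
by field.
Qed.

Lemma inord_eq (i j : nat) : (i < 7)%N -> (j < 7)%N ->
  (inord i == inord j :> 'I_7) = (i == j).
Proof. by move=> i7 j7; rewrite -val_eqE /= !inordK. Qed.

Lemma coef_elem_act a b s w i j k : (i < 7)%N -> (j < 7)%N -> (k < 7)%N -> (b < 7)%N ->
  coef (elem_act a b s w) i j k = coef w i j k
    + s * ((if i == b then coef w a j k else 0)
           + (if j == b then coef w i a k else 0)
           + (if k == b then coef w i j a else 0)).
Proof.
move=> i7 j7 k7 b7; rewrite /coef /elem_act /= !mxE !eqxx !andbT !inord_eq // !(eq_sym b).
by do 3!case: eqP => _; rewrite ?mul1r ?mul0r.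
Qed.

End Coefficients.

(** * Reduction to the Fano normal form *)

(** With sorted indices, coefficients that agree up to sign become one and the same atom for
    [field]. *)
Ltac coef_sort := repeat match goal with
  | Fw : form3 ?w |- context [coef ?w ?i ?i ?k] => rewrite !(@coef_alt12 _ w i k Fw)
  | Fw : form3 ?w |- context [coef ?w ?k ?i ?i] => rewrite !(@coef_alt23 _ w i k Fw)
  | Fw : form3 ?w |- context [coef ?w ?i ?k ?i] => rewrite !(@coef_alt13 _ w i k Fw)
  | Fw : form3 ?w |- context [coef ?w ?j ?i ?k] =>
      lazymatch eval compute in (ltn i j) with
      true => rewrite !(@coef_swap12 _ w i j k Fw) end
  | Fw : form3 ?w |- context [coef ?w ?i ?k ?j] =>
      lazymatch eval compute in (ltn j k) with
      true => rewrite !(@coef_swap23 _ w i j k Fw) end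
  end.

Section Reduction.
Variable R : realType.
Implicit Types w : tensor3 R.

Definition vanish w (l : seq (nat * nat * nat)) : Prop :=
  foldr (fun t P => coef w t.1.1 t.1.2 t.2 = 0 /\ P) True l.

(** An entry [(a, b, s)] replaces e_b by e_b + s e_a, where s is a function of the form; for a = b
    it scales e_b by 1 + s. *)
Definition instr : Type := nat * nat * (tensor3 R -> R).

(* The parameters are all evaluated at the initial form, and the head of the
   list acts last. *)
Definition run (l : seq instr) w : tensor3 R :=
  foldr (fun o v => elem_act o.1.1 o.1.2 (o.2 w) v) w l.

(* [elem_coef], [mem3] and [coef_sorted] let [cbv] compute the coefficients of
   [run l w] on concrete indices; they branch on [Nat.eqb] and [Nat.ltb] so that
   the reduction never touches the operations of [R]. *)
Definition elem_coef (a b : nat) (s : R) (c : nat -> nat -> nat -> R) i j k : R :=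
  if [|| Nat.eqb i j, Nat.eqb j k | Nat.eqb i k] then 0
  else if Nat.eqb i b then c i j k + s * c a j k
  else if Nat.eqb j b then c i j k + s * c i a k
  else if Nat.eqb k b then c i j k + s * c i j a
  else c i j k.

Definition mem3 (zs : seq (nat * nat * nat)) i j k :=
  foldr (fun t b => [&& Nat.eqb i t.1.1, Nat.eqb j t.1.2 & Nat.eqb k t.2] || b)
    false zs.

(** Coefficients known to vanish become a literal 0 and drop out of the computed expressions. *)
Definition coef_or0 zs w i j k : R := if mem3 zs i j k then 0 else coef w i j k.

Definition coef_sorted zs w i j k : R :=
  if [|| Nat.eqb i j, Nat.eqb j k | Nat.eqb i k] then 0
  else if Nat.ltb i j then
    if Nat.ltb j k then coef_or0 zs w i j k
    else if Nat.ltb i k then - coef_or0 zs w i k j else coef_or0 zs w k i j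
  else if Nat.ltb i k then - coef_or0 zs w j i k
  else if Nat.ltb j k then coef_or0 zs w j k i else - coef_or0 zs w k j i.

Lemma NateqbE m n : Nat.eqb m n = (m == n).
Proof. by apply/idP/eqP => /PeanoNat.Nat.eqb_eq. Qed.

Lemma coef_or0E zs w i j k : vanish w zs -> coef_or0 zs w i j k = coef w i j k.
Proof.
rewrite /coef_or0; elim: zs => //= -[[p q] r] zs IH /= [h /IH].
rewrite !NateqbE; case: eqP => [->|] //=; case: eqP => [->|] //=.
by case: eqP => [->|] //=; rewrite h.
Qed.

Lemma coef_sortedE zs w i j k : form3 w -> vanish w zs ->
  coef_sorted zs w i j k = coef w i j k.
Proof.
move=> Fw vw; rewrite /coef_sorted !coef_or0E // !NateqbE.
case: eqP => [->|_] /=; first by rewrite coef_alt12.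
case: eqP => [->|_] /=; first by rewrite coef_alt23.
case: eqP => [->|_] /=; first by rewrite coef_alt13.
have ikj : coef w i k j = - coef w i j k by rewrite coef_swap23.
have jik : coef w j i k = - coef w i j k by rewrite coef_swap12.
have jki : coef w j k i = coef w i j k by rewrite coef_swap23 // jik opprK.
have kij : coef w k i j = coef w i j k by rewrite coef_swap12 // ikj opprK.
have kji : coef w k j i = - coef w i j k by rewrite coef_swap23 // kij.
rewrite ikj jik jki kij kji !opprK.
by do 4?case: ifP.
Qed.

Definition valid (l : seq instr) :=
  all (fun o => (o.1.1 < 7)%N && (o.1.2 < 7)%N) l.

Definition admissible (l : seq instr) w :=
  valid l && all (fun o => (o.1.1 != o.1.2) || (1 + o.2 w != 0)) l.

Lemma form3_elem_act a b s w : form3 w -> form3 (elem_act a b s w).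
Proof. by move=> Fw; rewrite elem_act_pull //; apply: form3_pull. Qed.

Lemma form3_run l w : form3 w -> form3 (run l w).
Proof. by move=> Fw; elim: l => //= o l; apply: form3_elem_act. Qed.

Lemma run_eqv l w : form3 w -> admissible l w -> eqv w (run l w).
Proof.
move=> Fw /andP []; elim: l => [_ _|o l IH /=]; first exact: eqv_refl.
move=> /andP [/andP [a7 b7] v] /andP [h hl]; apply: (eqv_trans (IH v hl)).
by apply: elem_act_eqv => //; apply: form3_run.
Qed.

Lemma coef_elem_actE a b s w i j k : form3 w -> [&& i < 7, j < 7 & k < 7]%N ->
  (b < 7)%N -> coef (elem_act a b s w) i j k = elem_coef a b s (coef w) i j k.
Proof.
move=> Fw /and3P [i7 j7 k7] b7; rewrite /elem_coef !NateqbE.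
case: eqP => [->|/eqP ij] /=; first by rewrite coef_alt12 //; apply: form3_elem_act.
case: eqP => [->|/eqP jk] /=; first by rewrite coef_alt23 //; apply: form3_elem_act.
case: eqP => [->|/eqP ik] /=; first by rewrite coef_alt13 //; apply: form3_elem_act.
rewrite coef_elem_act //.
case: (eqVneq i b) ij ik => [->|_] ij ik.
  by rewrite (eq_sym j) (negPf ij) (eq_sym k) (negPf ik) !addr0.
case: (eqVneq j b) jk => [->|_] jk.
  by rewrite (eq_sym k) (negPf jk) add0r addr0.
by case: eqP; rewrite !add0r // mulr0 addr0.
Qed.

Lemma coef_run zs l w i j k : form3 w -> vanish w zs ->
  valid l -> [&& i < 7, j < 7 & k < 7]%N ->
  coef (run l w) i j k
  = foldr (fun o c => elem_coef o.1.1 o.1.2 (o.2 w) c) (coef_sorted zs w) l i j k.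
Proof.
move=> Fw vw; elim: l i j k => [|o l IH] i j k /=.
  by move=> _ _; rewrite coef_sortedE.
move=> /andP [/andP [a7 b7] v] ijk; rewrite coef_elem_actE //; last exact: form3_run.
case/and3P: ijk => i7 j7 k7; rewrite /elem_coef.
have {}IH p q r : (p < 7)%N -> (q < 7)%N -> (r < 7)%N ->
    coef (run l w) p q r
    = foldr (fun o => elem_coef o.1.1 o.1.2 (o.2 w)) (coef_sorted zs w) l p q r.
  by move=> p7 q7 r7; apply: IH; rewrite // p7 q7.
by repeat (case: ifP => _; rewrite ?IH //).
Qed.

(* Write [x_i] for the index [i] and [y_i] for [i + 3], i = 1, 2, 3. The stages
   put the 2-form [i(e_0) w] into Darboux form (1 to 3), make the remaining
   3-form [rho] on the span of the x_i, y_i primitive by moving these vectors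
   along [e_0] (4), kill the symmetric matrix of coefficients [y x x] with a
   symplectic shear (5), diagonalize the one of coefficients [x y y] with
   GL_3 in Sp_6 (6, 7), and kill [y_1 y_2 y_3] (8). Each stage only divides by
   coefficients on the lines 014, 025, 036, 123, 156, 246, 345 of a Fano plane. *)
Definition zeros1 := [:: (0,1,2); (0,1,3); (0,1,5); (0,1,6);
                         (0,2,4); (0,3,4); (0,4,5); (0,4,6)]%N.
Definition zeros2 := zeros1 ++ [:: (0,2,3); (0,2,6); (0,3,5); (0,5,6)]%N.
Definition zeros5 := zeros2 ++
  [:: (1,2,4); (1,2,5); (1,2,6); (1,3,4); (1,3,5); (1,3,6);
      (2,3,4); (2,3,5); (2,3,6)]%N.
Definition zeros6 := zeros5 ++ [:: (1,4,5); (1,4,6); (2,5,6); (3,5,6)]%N.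
Definition zeros7 := zeros6 ++ [:: (2,4,5); (3,4,6)]%N.
Definition zeros8 := zeros7 ++ [:: (4,5,6)]%N.

Definition unit_pairing w := [/\ coef w 0 1 4 = 1, coef w 0 2 5 = 1 & coef w 0 3 6 = 1].

Definition stage1 w := vanish w zeros1 /\ coef w 0 1 4 = 1.

Definition stage2 w := [/\ vanish w zeros2, coef w 0 1 4 = 1 & coef w 0 2 5 = 1].

Definition stage3 w := vanish w zeros2 /\ unit_pairing w.

(** The six equations say that [trace w u] vanishes for u = 1, ..., 6. Equivalently, the 3 x 3
    matrices of coefficients y x x and x y y are symmetric. *)
Definition stage4 w := [/\ vanish w zeros2, unit_pairing w,
  [/\ coef w 2 3 6 = coef w 1 2 4, coef w 2 3 5 = - coef w 1 3 4
    & coef w 1 3 6 = - coef w 1 2 5] &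
  [/\ coef w 3 4 6 = - coef w 2 4 5, coef w 3 5 6 = coef w 1 4 5
    & coef w 2 5 6 = - coef w 1 4 6]].

Definition stage5 w := [/\ vanish w zeros5, unit_pairing w, coef w 1 2 3 != 0 &
  [/\ coef w 3 4 6 = - coef w 2 4 5, coef w 3 5 6 = coef w 1 4 5
    & coef w 2 5 6 = - coef w 1 4 6]].

Definition stage6 w := [/\ vanish w zeros6, unit_pairing w,
  coef w 1 2 3 != 0 /\ coef w 1 5 6 != 0 & coef w 3 4 6 = - coef w 2 4 5].

Definition stage7 w := [/\ vanish w zeros7, unit_pairing w &
  [/\ coef w 1 2 3 != 0, coef w 1 5 6 != 0 & coef w 2 4 6 != 0]].

Definition stage8 w := [/\ vanish w zeros8, unit_pairing w &
  [/\ coef w 1 2 3 != 0, coef w 1 5 6 != 0 & coef w 2 4 6 != 0]].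

(** The contraction of [rho] with the bivector dual to the Darboux form; it vanishes for all u
    exactly when [rho] is primitive. *)
Definition trace w u : R := coef w u 1 4 + coef w u 2 5 + coef w u 3 6.

(** Symplectic Gram-Schmidt for i(e_0) w, read from the end: the other vectors are made orthogonal
    to y_1, then to x_1, and y_1 is rescaled to pair to 1 with x_1. *)
Definition step1 : seq instr :=
  (4%N, 4%N, fun w => (coef w 0 1 4)^-1 - 1)
  :: [seq (4%N, u, fun w => - coef w 0 1 u / coef w 0 1 4) | u <- [:: 2; 3; 5; 6]%N]
  ++ [seq (1%N, u, fun w => coef w 0 4 u / coef w 0 1 4) | u <- [:: 2; 3; 5; 6]%N].

Definition step2 : seq instr :=
  (5%N, 5%N, fun w => (coef w 0 2 5)^-1 - 1)
  :: [seq (5%N, u, fun w => - coef w 0 2 u / coef w 0 2 5) | u <- [:: 3; 6]%N]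
  ++ [seq (2%N, u, fun w => coef w 0 5 u / coef w 0 2 5) | u <- [:: 3; 6]%N].

Definition step3 : seq instr := [:: (6%N, 6%N, fun w => (coef w 0 3 6)^-1 - 1)].

(** Replacing every e_u by e_u + s_u e_0 adds 2 s_u to [trace w u]: the pair containing e_u
    contributes 0, each of the other two adds s_u. *)
Definition step4 : seq instr :=
  [seq (0%N, u, fun w => - trace w u / 2) | u <- iota 1 6].

(** Adding s_ij x_j to y_i adds s_ij times the coefficient on 123 to the (i, j) entry of the matrix
    y x x. That matrix is symmetric, so the shear that cancels it preserves the Darboux form. *)
Definition step5 : seq instr :=
  [:: (1%N, 4%N, fun w => - coef w 4 2 3 / coef w 1 2 3);
      (2%N, 4%N, fun w => - coef w 4 3 1 / coef w 1 2 3);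
      (3%N, 4%N, fun w => - coef w 4 1 2 / coef w 1 2 3);
      (1%N, 5%N, fun w => - coef w 5 2 3 / coef w 1 2 3);
      (2%N, 5%N, fun w => - coef w 5 3 1 / coef w 1 2 3);
      (3%N, 5%N, fun w => - coef w 5 1 2 / coef w 1 2 3);
      (1%N, 6%N, fun w => - coef w 6 2 3 / coef w 1 2 3);
      (2%N, 6%N, fun w => - coef w 6 3 1 / coef w 1 2 3);
      (3%N, 6%N, fun w => - coef w 6 1 2 / coef w 1 2 3)].

(** Symmetric Gaussian elimination with pivot on 156. Each change of a y comes with the
    contragredient change of an x, which keeps the pairing. [step7] does the same with the pivot on
    246. *)
Definition step6 : seq instr :=
  [:: (1%N, 2%N, fun w => - coef w 1 6 4 / coef w 1 5 6);
      (5%N, 4%N, fun w => coef w 1 6 4 / coef w 1 5 6);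
      (1%N, 3%N, fun w => - coef w 1 4 5 / coef w 1 5 6);
      (6%N, 4%N, fun w => coef w 1 4 5 / coef w 1 5 6)].

Definition step7 : seq instr :=
  [:: (2%N, 3%N, fun w => coef w 2 4 5 / coef w 2 4 6);
      (6%N, 5%N, fun w => - coef w 2 4 5 / coef w 2 4 6)].

(* In dual coordinates, with a, t_1, t_2, t_3 the coefficients on 123, 156, 264,
   345 and b the one on 456, this completes
   [a x1 x2 x3 + t1 x1 y2 y3 + t2 y1 x2 y3 + t3 y1 y2 x3 + b y1 y2 y3] to the same
   expression without [b], in the variables [x1 + b/(2 t1) y1],
   [x2 + b/(2 t2) y2] and [y3 - a b/(2 t1 t2) x3]; the new t_3 is
   [t3 + a b^2/(4 t1 t2)]. *)
Definition step8 : seq instr :=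
  [:: (6%N, 3%N, fun w =>
         - coef w 1 2 3 * coef w 4 5 6 / (2 * coef w 1 5 6 * coef w 2 4 6));
      (1%N, 4%N, fun w => - coef w 4 5 6 / (2 * coef w 1 5 6));
      (2%N, 5%N, fun w => coef w 4 5 6 / (2 * coef w 2 4 6))].

End Reduction.

Arguments run : simpl never.
Arguments step1 {R}.
Arguments step2 {R}.
Arguments step3 {R}.
Arguments step4 {R}.
Arguments step5 {R}.
Arguments step6 {R}.
Arguments step7 {R}.
Arguments step8 {R}.

Ltac coef_calc zs :=
  match goal with
  | Fw : form3 ?w, v : vanish ?w zs |- context [coef (run ?l ?w) ?i ?j ?k] =>
    rewrite (@coef_run _ zs l w i j k Fw v erefl erefl);
    cbv [foldr fst snd elem_coef coef_sorted coef_or0 mem3 Nat.eqb Nat.ltb Nat.leb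
         zeros1 zeros2 zeros5 zeros6 zeros7 zeros8
         orb andb step1 step2 step3 step4 step5 step6 step7 step8 map cat iota trace]
  end.

Ltac coef_close := try (by field); try by rewrite ?(oppr0, mulr0, addr0).

Ltac split_all := repeat match goal with
  | |- _ /\ _ => split
  | |- and3 _ _ _ => split
  | |- and4 _ _ _ _ => split
  | |- True => exact I
  end.

Ltac stage_unfold := rewrite /stage1 /stage2 /stage3 /stage4 /stage5 /stage6
  /stage7 /stage8 /unit_pairing /vanish;
  cbv [foldr fst snd zeros1 zeros2 zeros5 zeros6 zeros7 zeros8 cat].

(** * Each step establishes the next stage *)

Section Steps.
Variable R : realType.
Implicit Types w : tensor3 R.

Lemma step1P w : form3 w -> coef w 0 1 4 != 0 -> stage1 (run step1 w).
Proof.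
move=> Fw p; have v : vanish w [::] by [].
stage_unfold; split_all; coef_calc ([::] : seq (nat * nat * nat)); coef_sort;
  coef_close.
Qed.

Lemma step2P w : form3 w -> stage1 w -> coef w 0 2 5 != 0 -> stage2 (run step2 w).
Proof.
move=> Fw [v c1] p.
stage_unfold; split_all; coef_calc zeros1; coef_sort;
  rewrite ?c1; coef_close.
Qed.

Lemma step3P w : form3 w -> stage2 w -> coef w 0 3 6 != 0 -> stage3 (run step3 w).
Proof.
move=> Fw [v c1 c2] p.
stage_unfold; split_all; coef_calc zeros2; coef_sort;
  rewrite ?c1 ?c2; coef_close.
Qed.

Lemma step4P w : form3 w -> stage3 w -> stage4 (run step4 w).
Proof.
move=> Fw [v [c1 c2 c3]].
stage_unfold; split_all; do ?coef_calc zeros2; coef_sort;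
  rewrite ?c1 ?c2 ?c3; coef_close.
Qed.

Lemma step5P w : form3 w -> stage4 w -> coef w 1 2 3 != 0 -> stage5 (run step5 w).
Proof.
move=> Fw [v [c1 c2 c3] [S1 S2 S3] [T1 T2 T3]] p.
stage_unfold; split_all; do ?coef_calc zeros2; coef_sort;
  rewrite ?c1 ?c2 ?c3 ?S1 ?S2 ?S3 ?T1 ?T2 ?T3; coef_close.
Qed.

Lemma step6P w : form3 w -> stage5 w -> coef w 1 5 6 != 0 -> stage6 (run step6 w).
Proof.
move=> Fw [v [c1 c2 c3] a [T1 T2 T3]] p.
stage_unfold; split_all; do ?coef_calc zeros5; coef_sort;
  rewrite ?c1 ?c2 ?c3 ?T1 ?T2 ?T3; coef_close.
Qed.

Lemma step7P w : form3 w -> stage6 w -> coef w 2 4 6 != 0 -> stage7 (run step7 w).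
Proof.
move=> Fw [v [c1 c2 c3] [a t1] T1] p.
stage_unfold; split_all; do ?coef_calc zeros6; coef_sort;
  rewrite ?c1 ?c2 ?c3 ?T1; coef_close.
Qed.

Lemma step8P w : form3 w -> stage7 w -> stage8 (run step8 w).
Proof.
move=> Fw [v [c1 c2 c3] [a t1 t2]].
stage_unfold; split_all; do ?coef_calc zeros7; coef_sort;
  rewrite ?c1 ?c2 ?c3; try (by field; rewrite ?t1 ?t2); coef_close.
Qed.

End Steps.

(** * Forms supported on the lines of a Fano plane *)

Section Fano.
Variable R : realType.
Implicit Types w : tensor3 R.

Lemma wedge3E (a b c : covec7 R) X Y Z : wedge3 a b c (X, Y, Z)
  = a X * (b Y * c Z - b Z * c Y) - a Y * (b X * c Z - b Z * c X)
    + a Z * (b X * c Y - b Y * c X).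
Proof.
rewrite /wedge3 (expand_det_row _ ord0) !big_ord_recl big_ord0 /cofactor.
rewrite !(expand_det_row _ ord0) !big_ord_recl !big_ord0 /cofactor !det_mx11 !mxE /=.
by rewrite /bump /= !(addn0, add0n) expr0 expr1 sqrrN expr1n; ring.
Qed.

Lemma covec_linear (a : covec7 R) (s : R) (X Y : vec7 R) :
  a (s *: X + Y) = s * (a X : R) + a Y :> R.
Proof. exact: linearP. Qed.

Lemma form3_wedge3 (a b c : covec7 R) : form3 (wedge3 a b c).
Proof.
split; first split=> A B s X Y.
- by rewrite !wedge3E !covec_linear; ring.
- by rewrite !wedge3E !covec_linear; ring.
- by rewrite !wedge3E !covec_linear; ring.
- by move=> X Y; rewrite !wedge3E; split; ring.
Qed.

Lemma form3D w w' : form3 w -> form3 w' -> form3 (fun v => w v + w' v).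
Proof.
move=> Fw Fw'; split; first split=> A B s X Y.
- by rewrite !trilinD1 // !trilinZ1 //; ring.
- by rewrite !trilinD2 // !trilinZ2 //; ring.
- by rewrite !trilinD3 // !trilinZ3 //; ring.
- by move=> X Y; rewrite !alt12 // !alt13 // !alt23 // addr0.
Qed.

Lemma form3Z s w : form3 w -> form3 (fun v => s * w v).
Proof.
move=> Fw; split; first split=> A B k X Y.
- by rewrite trilinD1 // trilinZ1 //; ring.
- by rewrite trilinD2 // trilinZ2 //; ring.
- by rewrite trilinD3 // trilinZ3 //; ring.
- by move=> X Y; rewrite alt12 // alt13 // alt23 // mulr0.
Qed.

Lemma form3N w : form3 w -> form3 (fun v => - w v).
Proof.
move=> Fw; suff -> : (fun v => - w v) = (fun v => -1 * w v) :> tensor3 R by apply: form3Z.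
by apply/funext => v; rewrite mulN1r.
Qed.

(** The basis 3-forms in the canonical coordinates, with indices starting at 0. *)
Definition bwedge (i j k : nat) : tensor3 R :=
  wedge3 (coord7 R (inord i)) (coord7 R (inord j)) (coord7 R (inord k)).

Definition kron (i j : nat) : R := if Nat.eqb i j then 1 else 0.

Definition wedge_coef (i j k p q r : nat) : R :=
  kron i p * (kron j q * kron k r - kron j r * kron k q)
  - kron i q * (kron j p * kron k r - kron j r * kron k p)
  + kron i r * (kron j p * kron k q - kron j q * kron k p).

Lemma coef_bwedge i j k p q r :
  [&& i < 7, j < 7 & k < 7]%N -> [&& p < 7, q < 7 & r < 7]%N ->
  coef (bwedge i j k) p q r = wedge_coef i j k p q r.
Proof.
move=> /and3P [i7 j7 k7] /and3P [p7 q7 r7].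
have E m n : (m < 7)%N -> (n < 7)%N -> coord7 R (inord m) (bvec R n) = kron m n.
  move=> m7 n7; rewrite coord7E mxE eqxx andbT inord_eq // /kron NateqbE.
  by case: eqP.
by rewrite /coef /bwedge wedge3E !E.
Qed.

Definition triples : seq (nat * nat * nat) :=
 [:: (0,1,2); (0,1,3); (0,1,4); (0,1,5); (0,1,6); (0,2,3); (0,2,4);
     (0,2,5); (0,2,6); (0,3,4); (0,3,5); (0,3,6); (0,4,5); (0,4,6);
     (0,5,6); (1,2,3); (1,2,4); (1,2,5); (1,2,6); (1,3,4); (1,3,5);
     (1,3,6); (1,4,5); (1,4,6); (1,5,6); (2,3,4); (2,3,5); (2,3,6);
     (2,4,5); (2,4,6); (2,5,6); (3,4,5); (3,4,6); (3,5,6); (4,5,6)]%N.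

Lemma triplesP i j k : (i < j)%N -> (j < k)%N -> (k < 7)%N -> (i, j, k) \in triples.
Proof.
move=> ij jk k7; have j7 := ltn_trans jk k7; have i7 := ltn_trans ij j7.
by do 7?[case: i ij i7 => [|i] // ij i7]; do 7?[case: j ij jk j7 => [|j] // ij jk j7];
   do 7?[case: k jk k7 => [|k] // jk k7].
Qed.

(** Extensionality as an explicit conjunction, which [cbv] and [split_all] turn into 35 concrete
    goals. *)
Lemma form_ext35 w w' : form3 w -> form3 w' ->
  foldr (fun t P => coef w t.1.1 t.1.2 t.2 = coef w' t.1.1 t.1.2 t.2 /\ P) True triples ->
  w = w'.
Proof.
move=> Fw Fw' h; apply: form_ext => // i j k ij jk k7.
move: h (triplesP ij jk k7); elim: triples => //= t l IH [ht hl].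
by rewrite inE => /orP [/eqP tE|/(IH hl) //]; move: ht; rewrite -tE.
Qed.

(* The 3-forms supported on the lines of a Fano plane; the order 264 makes the
   cyclic permutation of the pairs (x_i, y_i) act without signs. *)
Definition fano (c1 c2 c3 a t1 t2 t3 : R) : tensor3 R := fun v =>
  c1 * bwedge 0 1 4 v + c2 * bwedge 0 2 5 v + c3 * bwedge 0 3 6 v
  + a * bwedge 1 2 3 v + t1 * bwedge 1 5 6 v + t2 * bwedge 2 6 4 v + t3 * bwedge 3 4 5 v.

Lemma form3_fano c1 c2 c3 a t1 t2 t3 : form3 (fano c1 c2 c3 a t1 t2 t3).
Proof.
by do 6?apply: form3D; apply: form3Z; apply: form3_wedge3.
Qed.

Lemma coef_fano c1 c2 c3 a t1 t2 t3 p q r : [&& p < 7, q < 7 & r < 7]%N ->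
  coef (fano c1 c2 c3 a t1 t2 t3) p q r =
  c1 * wedge_coef 0 1 4 p q r + c2 * wedge_coef 0 2 5 p q r
  + c3 * wedge_coef 0 3 6 p q r + a * wedge_coef 1 2 3 p q r
  + t1 * wedge_coef 1 5 6 p q r + t2 * wedge_coef 2 6 4 p q r
  + t3 * wedge_coef 3 4 5 p q r.
Proof. by move=> pqr; rewrite -!coef_bwedge. Qed.

(** The coefficient on 246 is [- t2] because [fano] orients this line as 264. *)
Lemma fano_coefs c1 c2 c3 a t1 t2 t3 (w := fano c1 c2 c3 a t1 t2 t3) :
  vanish w zeros8 /\
  ([/\ coef w 0 1 4 = c1, coef w 0 2 5 = c2 & coef w 0 3 6 = c3] /\
  [/\ coef w 1 2 3 = a, coef w 1 5 6 = t1, coef w 2 4 6 = - t2 & coef w 3 4 5 = t3]).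
Proof.
rewrite /w {w}; stage_unfold; split_all; rewrite coef_fano //;
  cbv [wedge_coef kron Nat.eqb]; ring.
Qed.

Lemma vanish_fano w : form3 w -> vanish w zeros8 ->
  w = fano (coef w 0 1 4) (coef w 0 2 5) (coef w 0 3 6) (coef w 1 2 3) (coef w 1 5 6)
       (- coef w 2 4 6) (coef w 3 4 5).
Proof.
move=> Fw v; apply: form_ext35 => //; first exact: form3_fano.
have := fano_coefs (coef w 0 1 4) (coef w 0 2 5) (coef w 0 3 6) (coef w 1 2 3)
  (coef w 1 5 6) (- coef w 2 4 6) (coef w 3 4 5).
move: (fano _ _ _ _ _ _ _) => u.
move: v; stage_unfold; cbv [triples] => v [v' [[-> -> ->] [-> -> -> ->]]].
(* The 28 triples of [zeros8] are the 35 increasing triples minus the seven lines. *)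
rewrite opprK; do 28!(case: v => -> v); do 28!(case: v' => -> v').
by split_all.
Qed.

End Fano.

(** * Classification of the Fano forms *)

Section Classification.
Variable R : realType.
Implicit Types w u : tensor3 R.

(** A common factor on three basis vectors multiplies their coefficient by its cube, so
    normalizations need cube roots. Cubing is odd, which reduces to the positive case, solved by exp
    and ln. *)
Lemma cuberoot (x : R) : x != 0 -> exists2 y : R, y != 0 & y ^+ 3 = x.
Proof.
have pos (z : R) : 0 < z -> exists2 y : R, y != 0 & y ^+ 3 = z.
  move=> z0; exists (expR (ln z / 3)); first by rewrite gt_eqF ?expR_gt0.
  by rewrite -expRM_natl mulrC divfK // lnK // posrE.
move=> x0; have [/pos //|x_le0] := ltP 0 x.
have /pos [y y0 yx] : 0 < - x by rewrite oppr_gt0 lt_neqAle x0.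
by exists (- y); rewrite ?oppr_eq0 // exprNn yx -signr_odd /= expr1 mulN1r opprK.
Qed.

Lemma eqv_frame g w w' : form3 w -> form3 w' -> g \in unitmx ->
  foldr (fun t P => coef w' t.1.1 t.1.2 t.2
      = w (g *m bvec R t.1.1, g *m bvec R t.1.2, g *m bvec R t.2) /\ P) True triples ->
  eqv w w'.
Proof.
move=> Fw Fw' gU h; exists g => //; apply: form_ext35 => //.
exact: form3_pull.
Qed.

(** The matrix sends the n-th basis vector to [s_n] times the one of index [sg_n], so it only
    permutes and rescales coefficients; [g'] is its inverse. *)
Lemma eqv_monomial (sg : seq nat) (s : seq R) w w' : form3 w -> form3 w' ->
  size sg = 7%N -> uniq sg -> all (fun i => i < 7)%N sg -> size s = 7%N ->
  all (fun x => x != 0) s ->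
  foldr (fun t P => coef w' t.1.1 t.1.2 t.2
    = nth 0 s t.1.1 * nth 0 s t.1.2 * nth 0 s t.2
      * coef w (nth 0%N sg t.1.1) (nth 0%N sg t.1.2) (nth 0%N sg t.2) /\ P)
    True triples ->
  eqv w w'.
Proof.
move=> Fw Fw' sgn sgu sg7 sn s0 h.
pose g : 'M[R]_7 := \matrix_(p, q) (if p == inord (nth 0%N sg q) then nth 0 s q else 0).
pose g' : 'M[R]_7 :=
  \matrix_(q, p) (if p == inord (nth 0%N sg q) then (nth 0 s q)^-1 else 0).
have sgE (q : 'I_7) : (nth 0%N sg q < 7)%N by apply: (allP sg7); rewrite mem_nth ?sgn.
have gU : g \in unitmx.
  suff /mulmx1_unit [] : g' *m g = 1%:M by [].
  apply/matrixP => q r; rewrite !mxE (bigD1 (inord (nth 0%N sg q))) //= !mxE eqxx.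
  rewrite big1 => [|i /negPf iq]; last by rewrite !mxE iq mul0r.
  rewrite inord_eq // nth_uniq ?sgn // addr0 -val_eqE /=.
  have [qr|_] := eqVneq (val q) (val r); last by rewrite mulr0.
  by rewrite (val_inj qr) mulVf //; apply: (allP s0); rewrite mem_nth ?sn.
have gE n : (n < 7)%N -> g *m bvec R n = nth 0 s n *: bvec R (nth 0%N sg n).
  move=> n7; apply/matrixP => p q; rewrite !mxE (bigD1 (inord n)) //= !mxE.
  rewrite inordK // eqxx (ord1 q) eqxx /= mulr1 big1 => [|i ip].
    by rewrite addr0 andbT; case: eqP; rewrite ?mulr1 ?mulr0.
  by rewrite !mxE (negPf ip) mulr0.
apply: (@eqv_frame g) => //.
have T : all (fun t => [&& t.1.1 < 7, t.1.2 < 7 & t.2 < 7]%N) triples by [].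
elim: triples T h => //= t l IH /andP [/and3P [t1 t2 t3] tl] [ht hl].
split; last exact: IH.
by rewrite ht !gE // trilinZ1 // trilinZ2 // trilinZ3 // /coef !mulrA.
Qed.

Lemma Omega0E : Omega0 R = fun v => - 2 * (bwedge 0 1 4 v + bwedge 0 2 5 v + bwedge 0 3 6 v)
  - 4 * bwedge 1 2 3 v + 4 * bwedge 4 5 6 v.
Proof. by []. Qed.

Lemma form3_Omega0 : form3 (Omega0 R).
Proof.
rewrite Omega0E; apply: form3D; last by apply: form3Z; apply: form3_wedge3.
apply: form3D; last by apply: form3N; apply: form3Z; apply: form3_wedge3.
by apply: form3Z; do 2?apply: form3D; apply: form3_wedge3.
Qed.

Lemma coef_Omega0 p q r : [&& p < 7, q < 7 & r < 7]%N ->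
  coef (Omega0 R) p q r =
  - 2 * (wedge_coef R 0 1 4 p q r + wedge_coef R 0 2 5 p q r + wedge_coef R 0 3 6 p q r)
  - 4 * wedge_coef R 1 2 3 p q r + 4 * wedge_coef R 4 5 6 p q r.
Proof. by move=> pqr; rewrite -!coef_bwedge. Qed.

(* If a t1 t2 t3 = q^2 > 0, the 3-form on the span of the x_i, y_i is the sum of
   two decomposable ones: with p_i = q / (a t_i) it is, in dual coordinates,
   [a/2 (prod_i (x_i + p_i y_i) + prod_i (x_i - p_i y_i))]. The new basis is dual
   to these factors, with r_i = 1 / p_i. *)
Definition to_split (r1 r2 r3 : R) : seq (instr R) :=
  [:: (1%N, 4%N, fun _ => - (2 * r1)^-1); (2%N, 5%N, fun _ => - (2 * r2)^-1);
      (3%N, 6%N, fun _ => - (2 * r3)^-1);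
      (4%N, 1%N, fun _ => r1); (5%N, 2%N, fun _ => r2); (6%N, 3%N, fun _ => r3)].

Definition zeros_split := zeros7 ++ [:: (1,5,6); (2,4,6); (3,4,5)]%N.

(** Expressing t_3 through q keeps everything rational: the parameters are r_i = a t_i / q, and r_3
    becomes q / (t_1 t_2). *)
Lemma run_to_split w (a t1 t2 q : R) : form3 w -> vanish w zeros8 ->
  a != 0 -> t1 != 0 -> t2 != 0 -> q != 0 ->
  coef w 1 2 3 = a -> coef w 1 5 6 = t1 -> coef w 2 4 6 = - t2 ->
  coef w 3 4 5 = q ^+ 2 / (a * t1 * t2) ->
  let w' := run (to_split (a * t1 / q) (a * t2 / q) (q / (t1 * t2))) w in
  vanish w' zeros_split /\
  ([/\ coef w' 0 1 4 = coef w 0 1 4, coef w' 0 2 5 = coef w 0 2 5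
     & coef w' 0 3 6 = coef w 0 3 6] /\
  (coef w' 1 2 3 = 4 * a /\ coef w' 4 5 6 = - q / (2 * a))).
Proof.
move=> Fw v an t1n t2n qn A T1 T2 T3 /=.
stage_unfold; cbv [zeros_split cat foldr zeros1 zeros2 zeros5 zeros6 zeros7 fst snd].
have qtt : q / (t1 * t2) != 0 by rewrite mulf_neq0 ?invr_eq0 ?mulf_neq0.
split_all; coef_calc zeros8; cbv [foldr fst snd elem_coef coef_sorted coef_or0 mem3
  Nat.eqb Nat.ltb Nat.leb zeros1 zeros2 zeros5 zeros6 zeros7 zeros8 orb andb cat to_split].
all: rewrite ?A ?T1 ?T2 ?T3; try by [field | field; rewrite ?qn ?t1n ?t2n ?an].
Qed.

Lemma split_fano_rat (c1 c2 c3 a t1 t2 q : R) : c1 != 0 -> c2 != 0 -> c3 != 0 ->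
  a != 0 -> t1 != 0 -> t2 != 0 -> q != 0 ->
  eqv (fano c1 c2 c3 a t1 t2 (q ^+ 2 / (a * t1 * t2))) (Omega0 R).
Proof.
move=> c1n c2n c3n an t1n t2n qn.
have [] := fano_coefs c1 c2 c3 a t1 t2 (q ^+ 2 / (a * t1 * t2)).
have := form3_fano c1 c2 c3 a t1 t2 (q ^+ 2 / (a * t1 * t2)).
move: (fano _ _ _ _ _ _ _) => w Fw v [[C1 C2 C3] [A T1 T2 T3]].
have [v' [[]]] := run_to_split Fw v an t1n t2n qn A T1 T2 T3.
set l := to_split _ _ _ in v' *.
rewrite C1 C2 C3 => D1 D2 D3 [D4 D5].
have wl : eqv w (run l w) by apply: run_eqv.
apply: (eqv_trans wl).
(* Scaling the x_i by k turns 4 a on 123 into -4. Scaling e_0 by r, the value -2 on the lines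
   through e_0 then forces the scaling of the y_i, and r is chosen to give 4 on 456. *)
have [k kn kE] : exists2 k : R, k != 0 & k ^+ 3 = - a^-1.
  by apply: cuberoot; rewrite oppr_eq0 invr_eq0.
have [r rn rE] : exists2 r : R, r != 0 & r ^+ 3 = - q / (c1 * c2 * c3).
  by apply: cuberoot; rewrite mulf_neq0 ?oppr_eq0 // invr_eq0 !mulf_neq0.
have aE : a = - (k ^+ 3)^-1 by rewrite kE invrN opprK invrK.
have qE : q = - r ^+ 3 * (c1 * c2 * c3).
  by rewrite rE; field; rewrite c1n c2n c3n.
have Frw := form3_run l Fw.
move: (run l w) v' D1 D2 D3 D4 D5 Frw wl => w' v' D1 D2 D3 D4 D5 Fw' _.
apply: (@eqv_monomial (iota 0 7) [:: r; k; k; k; - 2 / (r * k * c1); - 2 / (r * k * c2);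
  - 2 / (r * k * c3)]) => //.
- exact: form3_Omega0.
- rewrite /= rn kn !mulf_neq0 ?invr_eq0 ?mulf_neq0 ?oppr_eq0 ?pnatr_eq0 //.
clear w Fw v l A T1 T2 T3 C1 C2 C3 kE rE.
move: v'; stage_unfold; cbv [zeros_split cat foldr zeros1 zeros2 zeros5 zeros6 zeros7 fst snd].
cbv [triples foldr fst snd nth iota] => v'.
rewrite D1 D2 D3 D4 D5; do 30!(case: v' => -> v').
split_all; rewrite coef_Omega0 //; cbv [wedge_coef kron Nat.eqb].
all: rewrite ?aE ?qE; try by [field | field; rewrite ?rn ?kn ?c1n ?c2n ?c3n].
Qed.

Lemma split_fano (c1 c2 c3 a t1 t2 t3 : R) : c1 != 0 -> c2 != 0 -> c3 != 0 ->
  0 < a * t1 * t2 * t3 -> eqv (fano c1 c2 c3 a t1 t2 t3) (Omega0 R).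
Proof.
move=> c1n c2n c3n p.
have [/eqP an t1n t2n t3n] : [/\ a <> 0, t1 != 0, t2 != 0 & t3 != 0].
  by split; [move=> a0|apply/eqP => a0..]; move: p; rewrite a0 ?(mulr0, mul0r) ltxx.
pose q := Num.sqrt (a * t1 * t2 * t3).
have qn : q != 0 by rewrite gt_eqF // sqrtr_gt0.
have -> : t3 = q ^+ 2 / (a * t1 * t2).
  by rewrite sqr_sqrtr ?ltW //; field; rewrite an t1n t2n.
exact: split_fano_rat.
Qed.

(** Stated with [coef_sorted], so that computation leaves only the coefficients on the lines. *)
Lemma eqv_fano_monomial (sg : seq nat) (s : seq R)
    (c1 c2 c3 a t1 t2 t3 c1' c2' c3' a' t1' t2' t3' : R)
    (w := fano c1 c2 c3 a t1 t2 t3) (w' := fano c1' c2' c3' a' t1' t2' t3') :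
  [&& size sg == 7%N, uniq sg & all (fun i => i < 7)%N sg] -> size s = 7%N ->
  all (fun x => x != 0) s ->
  foldr (fun t P => coef_sorted zeros8 w' t.1.1 t.1.2 t.2
    = nth 0 s t.1.1 * nth 0 s t.1.2 * nth 0 s t.2
      * coef_sorted zeros8 w (nth 0%N sg t.1.1) (nth 0%N sg t.1.2) (nth 0%N sg t.2) /\ P)
    True triples ->
  eqv w w'.
Proof.
move=> /and3P [/eqP sgn sgu sg7] sn s0 h.
apply: (@eqv_monomial sg s) => //; try exact: form3_fano.
have sorted k1 k2 k3 b r1 r2 r3 i j k :
    coef_sorted zeros8 (fano k1 k2 k3 b r1 r2 r3) i j k
    = coef (fano k1 k2 k3 b r1 r2 r3 : tensor3 R) i j k.
  apply: coef_sortedE; first exact: form3_fano.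
  by case: (fano_coefs k1 k2 k3 b r1 r2 r3).
by elim: triples h => //= t l IH [h /IH hl]; rewrite -!sorted.
Qed.

Lemma fano_coef_values (c1 c2 c3 a t1 t2 t3 : R) (w := fano c1 c2 c3 a t1 t2 t3) :
  (coef w 0 1 4 = c1) * (coef w 0 2 5 = c2) * (coef w 0 3 6 = c3) * (coef w 1 2 3 = a)
  * (coef w 1 5 6 = t1) * (coef w 2 4 6 = - t2) * (coef w 3 4 5 = t3).
Proof. by have [_ [[-> -> ->] [-> -> -> ->]]] := fano_coefs c1 c2 c3 a t1 t2 t3. Qed.

Ltac fano_calc :=
  cbv [triples foldr fst snd nth iota coef_sorted coef_or0 mem3 Nat.eqb Nat.ltb Nat.leb
       zeros1 zeros2 zeros5 zeros6 zeros7 zeros8 orb andb cat];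
  split_all; rewrite ?fano_coef_values.

Lemma fano_cycle (c1 c2 c3 a t1 t2 t3 : R) :
  eqv (fano c1 c2 c3 a t1 t2 t3) (fano c2 c3 c1 a t2 t3 t1).
Proof.
apply: (@eqv_fano_monomial [:: 0; 2; 3; 1; 5; 6; 4]%N [:: 1; 1; 1; 1; 1; 1; 1]) => //=.
  by rewrite oner_eq0.
fano_calc; ring.
Qed.

(* The same form seen from the point x_2 of the Fano plane instead of e_0; this
   reaches the case of [split_fano] when t1 and t3 have opposite signs. *)
Lemma fano_turn (a t1 t2 t3 : R) :
  eqv (fano 1 1 1 a t1 t2 t3) (fano 1 a t2 (- t1) (- t3) 1 (- 1)).
Proof.
apply: (@eqv_fano_monomial [:: 2; 5; 1; 6; 0; 3; 4]%N [:: 1; 1; 1; 1; 1; - 1; 1]) => //=.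
  by rewrite oppr_eq0 oner_eq0.
fano_calc; ring.
Qed.

(** A diagonal rescaling: the factors m_i make the t_i equal up to normalization, r brings the
    coefficient on 123 to 1, and the factors on the y_i keep the pairing. *)
Lemma compact_fano (a t1 t2 t3 : R) : a * t1 < 0 -> a * t2 < 0 -> a * t3 < 0 ->
  eqv (fano 1 1 1 a t1 t2 t3) (fano 1 1 1 1 (- 1) (- 1) (- 1)).
Proof.
move=> n1 n2 n3.
have an : a != 0 by apply/eqP => a0; move: n1; rewrite a0 mul0r ltxx.
have sq t : a * t < 0 -> exists2 m : R, m != 0 & t = - (a * m ^+ 2)^-1.
  move=> n; pose m := Num.sqrt (- (a * t)^-1); exists m.
    by rewrite gt_eqF // sqrtr_gt0 oppr_gt0 invr_lt0.
  rewrite sqr_sqrtr ?oppr_ge0 ?invr_le0 ?ltW //.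
  by field; rewrite an ?andbT; apply/eqP => t0; move: n; rewrite t0 mulr0 ltxx.
have [m1 m1n ->] := sq _ n1; have [m2 m2n ->] := sq _ n2.
have [m3 m3n ->] := sq _ n3.
have [r rn rE] : exists2 r : R, r != 0 & r ^+ 3 = (a * m1 * m2 * m3)^-1.
  by apply: cuberoot; rewrite invr_eq0 !mulf_neq0.
have -> : a = (r ^+ 3 * m1 * m2 * m3)^-1.
  by rewrite rE; field; rewrite an m1n m2n m3n.
apply: (@eqv_fano_monomial (iota 0 7) [:: r; r * m1; r * m2; r * m3;
   (r ^+ 2 * m1)^-1; (r ^+ 2 * m2)^-1; (r ^+ 2 * m3)^-1]) => //=.
  by rewrite rn !invr_eq0 ?mulf_neq0 ?expf_neq0.
fano_calc; try ring; field; rewrite ?rn ?m1n ?m2n ?m3n //.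
Qed.

(** If two of the t_i have opposite signs, a cyclic permutation and [fano_turn] lead to
    [split_fano]. If all have the same sign, [split_fano] applies when it is that of a,
    [compact_fano] when it is the opposite one. *)
Lemma fano_classification (a t1 t2 t3 : R) : a != 0 -> t1 != 0 -> t2 != 0 -> t3 != 0 ->
  eqv (fano 1 1 1 a t1 t2 t3) (Omega0 R)
  \/ eqv (fano 1 1 1 a t1 t2 t3) (fano 1 1 1 1 (- 1) (- 1) (- 1)).
Proof.
have turn b s1 s2 s3 : b != 0 -> s2 != 0 -> s1 * s3 < 0 ->
    eqv (fano 1 1 1 b s1 s2 s3) (Omega0 R).
  move=> bn s2n n; apply: (eqv_trans (fano_turn _ _ _ _)).
  by apply: split_fano; rewrite ?oner_eq0 //; lra.
move=> an t1n t2n t3n.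
have [n13|p13] := ltP (t1 * t3) 0; first by left; apply: turn.
have [n12|p12] := ltP (t1 * t2) 0.
  by left; apply: (eqv_trans (fano_cycle _ _ _ _ _ _ _)); apply: turn; rewrite // mulrC.
have {}p13 : 0 < t1 * t3 by rewrite lt_neqAle eq_sym mulf_neq0.
have {}p12 : 0 < t1 * t2 by rewrite lt_neqAle eq_sym mulf_neq0.
have [p|n] := ltP 0 (a * t1); [left|right].
  apply: split_fano; rewrite ?oner_eq0 // -mulrA.
  have h : 0 < t1 ^+ 2 * (t2 * t3).
    by rewrite (_ : _ * _ = t1 * t2 * (t1 * t3)); [exact: mulr_gt0|ring].
  by rewrite pmulr_rgt0 //; move: h; rewrite pmulr_rgt0 // exprn_even_gt0.
have {}n : a * t1 < 0 by rewrite lt_neqAle mulf_neq0.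
have neg t : 0 < t1 * t -> a * t < 0.
  move=> p; have h : (a * t) * t1 ^+ 2 < 0.
    by rewrite (_ : _ * _ = a * t1 * (t1 * t)); [rewrite nmulr_rlt0|ring].
  by move: h; rewrite pmulr_llt0 // exprn_even_gt0.
by apply: compact_fano => //; apply: neg.
Qed.

End Classification.

(** * Openness of the orbits and density of the Fano forms *)

Section Topology.
Variable R : realType.
Implicit Types w : tensor3 R.

Lemma cvg_tensorP (T : Type) (F : set_system T) (FF : Filter F)
    (W : T -> tensor3 R) w0 :
  W @ F --> w0 <-> (forall v, W t v @[t --> F] --> w0 v).
Proof. exact: (@pointwise_cvgP _ _ (W @ F) w0). Qed.

Lemma cvg_elem_act (T : Type) (F : set_system T) (FF : Filter F) a b (s : T -> R)
    (W : T -> tensor3 R) w0 :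
  s @ F --> (0 : R) -> W @ F --> w0 -> elem_act a b (s t) (W t) @[t --> F] --> w0.
Proof.
move=> s0 /cvg_tensorP W0; apply/cvg_tensorP => -[[X Y] Z] /=.
rewrite -[X in _ --> X]addr0; apply: cvgD; first exact: W0.
set r := (X in _ --> X).
have -> : r = 0 * (X (inord b) 0 * w0 (bvec R a, Y, Z)
                  + Y (inord b) 0 * w0 (X, bvec R a, Z)
                  + Z (inord b) 0 * w0 (X, Y, bvec R a)) by rewrite mul0r.
apply: cvgM => //; apply: cvgD; first apply: cvgD;
  apply: cvgM; by [exact: cvg_cst | exact: W0].
Qed.

Lemma cvg_coef (T : Type) (F : set_system T) (FF : Filter F) (W : T -> tensor3 R)
    w0 i j k : W @ F --> w0 -> coef (W t) i j k @[t --> F] --> coef w0 i j k.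
Proof. by move/cvg_tensorP; apply. Qed.

(** The elementary matrices tend to the identity when their parameters tend to 0. *)
Lemma cvg_run (T : Type) (F : set_system T) (FF : Filter F) (W : T -> tensor3 R)
    (l : seq (instr R)) w0 : W @ F --> w0 ->
  foldr (fun o P => o.2 (W t) @[t --> F] --> (0 : R) /\ P) True l ->
  run l (W t) @[t --> F] --> w0.
Proof.
move=> W0; elim: l => [_|o l IH]; first exact: W0.
case=> ho /IH hl.
exact: (@cvg_elem_act T F FF o.1.1 o.1.2 (o.2 \o W) (run l \o W) w0 ho hl).
Qed.

Section Tends.
Variables (T : Type) (F : set_system T) (FF : Filter F).
Implicit Types (f g : T -> R) (l m : R).

(* Stating the limit rules over an abstract domain keeps unification away from
   the topology of [tensor3 R]. *)
Definition tends f l := f @ F --> l.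

Lemma tends_cst l : tends (fun=> l) l. Proof. exact: cvg_cst. Qed.

Lemma tendsD f g l m : tends f l -> tends g m -> tends (fun t => f t + g t) (l + m).
Proof. exact: cvgD. Qed.

Lemma tendsN f l : tends f l -> tends (fun t => - f t) (- l).
Proof. exact: cvgN. Qed.

Lemma tendsM f g l m : tends f l -> tends g m -> tends (fun t => f t * g t) (l * m).
Proof. exact: cvgM. Qed.

Lemma tendsV f l : l != 0 -> tends f l -> tends (fun t => (f t)^-1) l^-1.
Proof. exact: cvgV. Qed.

Lemma tends_eq f l m : tends f l -> l = m -> f @ F --> m.
Proof. by move=> + <-. Qed.

End Tends.

Ltac tends_solve := repeat first
  [ apply: tends_cst | apply: tendsD | apply: tendsN | apply: tendsM | apply: tendsV
  | match goal with H : forall i j k, tends _ _ _ |- _ => apply: H end ].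

(* All parameters vanish at a Fano form [w0], so every step is continuous there
   and fixes it. *)
Lemma cvg_steps (T : Type) (F : set_system T) (FF : Filter F) (W : T -> tensor3 R) w0 :
  form3 w0 -> stage8 w0 -> W @ F --> w0 ->
  [/\ run step1 (W t) @[t --> F] --> w0, run step2 (W t) @[t --> F] --> w0,
      run step3 (W t) @[t --> F] --> w0 & run step4 (W t) @[t --> F] --> w0] /\
  [/\ run step5 (W t) @[t --> F] --> w0, run step6 (W t) @[t --> F] --> w0,
      run step7 (W t) @[t --> F] --> w0 & run step8 (W t) @[t --> F] --> w0].
Proof.
move=> Fw0 [v0 [c1 c2 c3] [an t1n t2n]] W0.
have cE i j k : coef w0 i j k = coef_sorted zeros8 w0 i j k.
  by rewrite (coef_sortedE _ _ _ Fw0 v0).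
have tends_coef i j k : tends F (fun t => coef (W t) i j k) (coef w0 i j k).
  exact: cvg_coef.
split; split; apply: cvg_run => //;
cbv [step1 step2 step3 step4 step5 step6 step7 step8 trace map cat iota foldr fst snd];
split_all.
all: apply: tends_eq; [by tends_solve; rewrite ?c1 ?c2 ?c3 ?mulf_neq0 ?pnatr_eq0 ?oner_eq0|].
all: rewrite !cE; cbv [coef_sorted coef_or0 mem3 Nat.eqb Nat.ltb Nat.leb foldr fst snd
  zeros1 zeros2 zeros5 zeros6 zeros7 zeros8 orb andb cat].
all: by rewrite ?c1 ?c2 ?c3 ?invr1 ?subrr ?(oppr0, mulr0, mul0r, addr0).
Qed.

Lemma scale_admissible (p : R) : p != 0 -> 1 + (p^-1 - 1) != 0.
Proof. by move=> p0; rewrite addrC subrK invr_eq0. Qed.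

Lemma step1_eqv w : form3 w -> coef w 0 1 4 != 0 -> eqv w (run step1 w).
Proof.
by move=> Fw p; apply: run_eqv => //; rewrite /admissible /= scale_admissible.
Qed.

Lemma step2_eqv w : form3 w -> coef w 0 2 5 != 0 -> eqv w (run step2 w).
Proof.
by move=> Fw p; apply: run_eqv => //; rewrite /admissible /= scale_admissible.
Qed.

Lemma step3_eqv w : form3 w -> coef w 0 3 6 != 0 -> eqv w (run step3 w).
Proof.
by move=> Fw p; apply: run_eqv => //; rewrite /admissible /= scale_admissible.
Qed.

Lemma near_run (F : set_system (tensor3 R)) (FF : Filter F) (P Q : tensor3 R -> Prop)
    (l : seq (instr R)) (W : tensor3 R -> tensor3 R) :
  (forall u, form3 u -> P u -> eqv u (run l u) /\ Q (run l u)) ->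
  (\forall w \near F, [/\ form3 (W w), eqv w (W w) & P (W w)]) ->
  \forall w \near F, [/\ form3 (run l (W w)), eqv w (run l (W w)) & Q (run l (W w))].
Proof.
move=> h; apply: filterS => w [Fw wW Pw]; have [e q] := h _ Fw Pw.
by split=> //; [exact: form3_run | exact: eqv_trans wW e].
Qed.

Lemma near_pivot (F : set_system (tensor3 R)) (FF : Filter F) (P : tensor3 R -> Prop)
    (W : tensor3 R -> tensor3 R) w0 i j k : W @ F --> w0 -> coef w0 i j k != 0 ->
  (\forall w \near F, [/\ form3 (W w), eqv w (W w) & P (W w)]) ->
  \forall w \near F, [/\ form3 (W w), eqv w (W w) & P (W w) /\ coef (W w) i j k != 0].
Proof.
move=> W0 p; have := @cvgr_neq0 _ _ _ F FF _ _ (@cvg_coef _ F FF W w0 i j k W0) p.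
move=> hp hn; apply: filterS (@filterI _ F FF _ _ hp hn).
by move=> w [pw [Fw wW Pw]].
Qed.

(** [W] is the composite of the eight steps. Its pivots are nonzero at [w0], hence near [w0], so
    each step applies to all forms of a neighbourhood. *)
Lemma near_stage8 w0 (F := within (@form3 R) (nbhs w0)) : form3 w0 -> stage8 w0 ->
  exists2 W : tensor3 R -> tensor3 R, W @ F --> w0 &
    \forall w \near F, [/\ form3 (W w), eqv w (W w) & stage8 (W w)].
Proof.
move=> Fw0 S0; have [_ [c1 c2 c3] [an t1n t2n]] := S0.
have FF : Filter F by apply: within_filter.
pose W0 : tensor3 R -> tensor3 R := id.
have e0 : W0 @ F --> w0 by apply: cvg_within.
have n0 : \forall w \near F, [/\ form3 (W0 w), eqv w (W0 w) & True].
  by apply: filterS (withinT _ _) => w Fw; split=> //; exact: eqv_refl.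
move: W0 e0 n0 => W0 e0 n0.
have p1 : coef w0 0 1 4 != 0 by rewrite c1 oner_eq0.
have p2 : coef w0 0 2 5 != 0 by rewrite c2 oner_eq0.
have p3 : coef w0 0 3 6 != 0 by rewrite c3 oner_eq0.
have [[e1 _ _ _] _] := cvg_steps FF Fw0 S0 e0.
have [[_ e2 _ _] _] := cvg_steps FF Fw0 S0 e1.
have [[_ _ e3 _] _] := cvg_steps FF Fw0 S0 e2.
have [[_ _ _ e4] _] := cvg_steps FF Fw0 S0 e3.
have [_ [e5 _ _ _]] := cvg_steps FF Fw0 S0 e4.
have [_ [_ e6 _ _]] := cvg_steps FF Fw0 S0 e5.
have [_ [_ _ e7 _]] := cvg_steps FF Fw0 S0 e6.
have [_ [_ _ _ e8]] := cvg_steps FF Fw0 S0 e7.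
eexists; first exact: e8.
(* The steps are peeled off from the last one; [near_pivot] supplies each new divisor, and steps 4
   and 8 have none. *)
apply: (@near_run F FF (@stage7 R)).
  by move=> u Fu S; split; [apply: run_eqv | apply: step8P].
apply: (@near_run F FF (fun u => stage6 u /\ coef u 2 4 6 != 0)).
  by move=> u Fu [S p]; split; [apply: run_eqv | apply: step7P].
apply: near_pivot e6 t2n _.
apply: (@near_run F FF (fun u => stage5 u /\ coef u 1 5 6 != 0)).
  by move=> u Fu [S p]; split; [apply: run_eqv | apply: step6P].
apply: near_pivot e5 t1n _.
apply: (@near_run F FF (fun u => stage4 u /\ coef u 1 2 3 != 0)).
  by move=> u Fu [S p]; split; [apply: run_eqv | apply: step5P].
apply: near_pivot e4 an _.
apply: (@near_run F FF (@stage3 R)).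
  by move=> u Fu S; split; [apply: run_eqv | apply: step4P].
apply: (@near_run F FF (fun u => stage2 u /\ coef u 0 3 6 != 0)).
  by move=> u Fu [S p]; split; [apply: step3_eqv | apply: step3P].
apply: near_pivot e2 p3 _.
apply: (@near_run F FF (fun u => stage1 u /\ coef u 0 2 5 != 0)).
  by move=> u Fu [S p]; split; [apply: step2_eqv | apply: step2P].
apply: near_pivot e1 p2 _.
apply: (@near_run F FF (fun u => True /\ coef u 0 1 4 != 0)).
  by move=> u Fu [S p]; split; [apply: step1_eqv | apply: step1P].
exact: (@near_pivot F FF (fun=> True) W0 w0 _ _ _ e0 p1 n0).
Qed.

End Topology.

(** * Open orbits: homogeneity and perturbation *)

Section Orbits.
Variable R : realType.
Implicit Types w : tensor3 R.

(** At a point of [form3], the neighbourhoods in the subspace are those of the [within] filter. *)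
Lemma open_form3P (O : set (tensor3 R)) : O `<=` @form3 R ->
  open (O : set (subspace (@form3 R))) <->
  (forall w, O w -> \forall w' \near within (@form3 R) (nbhs w), O w').
Proof.
move=> OF; rewrite openE; split=> h w Ow;
  have e := @nbhs_subspace_in (tensor3 R : topologicalType) _ w (OF _ Ow).
  suff : @nbhs_subspace (tensor3 R : topologicalType) (@form3 R) w O by rewrite -e.
  exact: h.
suff : @nbhs_subspace (tensor3 R : topologicalType) (@form3 R) w O by [].
by rewrite -e; apply: h.
Qed.

Lemma orbit3_sub_form3 w : form3 w -> orbit3 w `<=` @form3 R.
Proof. by move=> Fw w' /orbit3P /eqv_form3; apply. Qed.

(** Homogeneity: [pull g] is continuous for pointwise convergence and preserves orbits, so it
    carries a neighbourhood of [w0] back to one of any other point of the orbit. *)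
Lemma open_orbit3 w0 : form3 w0 ->
  (\forall w \near within (@form3 R) (nbhs w0), eqv w0 w) ->
  open (orbit3 w0 : set (subspace (@form3 R))).
Proof.
move=> Fw0 n0; apply/(open_form3P (orbit3_sub_form3 Fw0)) => w /orbit3P w0w.
case: (eqv_sym w0w) => g gU w0E.
have h := (@cvg_tensorP R (tensor3 R) (nbhs w) (nbhs_filter w) id w).1 cvg_id.
have c : (pull g : tensor3 R -> tensor3 R) @ nbhs w --> w0.
  apply: (@cvg_tensorP R (tensor3 R) (nbhs w) (nbhs_filter w) (pull g) w0).2.
  move=> -[[X Y] Z].
  have -> : w0 (X, Y, Z) = w (g *m X, g *m Y, g *m Z) by rewrite w0E.
  exact: (h (g *m X, g *m Y, g *m Z)).
have {}c := c _ n0.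
suff : nbhs w (fun v => form3 v -> orbit3 w0 v) by [].
apply: (@filterS _ (nbhs w) (nbhs_filter w) _ _ _ c) => v hv Fv; apply/orbit3P.
apply: eqv_trans (hv (form3_pull g Fv)) _.
by apply: eqv_sym; exists g.
Qed.

Definition perturb i j k (s : R) w : tensor3 R := fun v => w v + s * bwedge i j k v.

Lemma form3_perturb i j k s w : form3 w -> form3 (perturb i j k s w).
Proof. by move=> Fw; apply: form3D => //; apply: form3Z; apply: form3_wedge3. Qed.

Lemma coef_perturb i j k s w p q r :
  [&& i < 7, j < 7 & k < 7]%N -> [&& p < 7, q < 7 & r < 7]%N ->
  coef (perturb i j k s w) p q r = coef w p q r + s * wedge_coef R i j k p q r.
Proof. by move=> ijk pqr; rewrite -coef_bwedge. Qed.

(** If the coefficient is 0, perturbing makes it s, and an open set contains the perturbed form for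
    all small s, in particular for some nonzero one. *)
Lemma open_pivot (O : set (tensor3 R)) i j k w : O `<=` @form3 R ->
  open (O : set (subspace (@form3 R))) -> O w ->
  [&& i < 7, j < 7, k < 7, i != j, j != k & i != k]%N ->
  exists s, O (perturb i j k s w) /\ coef (perturb i j k s w) i j k != 0.
Proof.
move=> OF Oo Ow /and5P [i7 j7 k7 ij /andP [jk ik]].
have E s : coef (perturb i j k s w) i j k = coef w i j k + s.
  rewrite coef_perturb ?i7 ?j7 ?k7 // /wedge_coef /kron !NateqbE !eqxx.
  by rewrite (negPf ij) (negPf jk) (negPf ik); ring.
have [w0|wn] := eqVneq (coef w i j k) 0; last first.
  exists 0; rewrite E addr0; split=> //; suff -> : perturb i j k 0 w = w by [].
  by apply/funext => v; rewrite /perturb mul0r addr0.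
have c : perturb i j k s w @[s --> (0 : R)] --> w.
  apply/cvg_tensorP => v; rewrite -[X in _ --> X]addr0.
  apply: cvgD; first exact: (@cvg_cst R (w v) R (nbhs (0 : R)) _).
  rewrite -[X in _ --> X](mul0r (bwedge i j k v)).
  apply: cvgM; first exact: cvg_id.
  exact: (@cvg_cst R (bwedge i j k v) R (nbhs (0 : R)) _).
have n : nbhs (0 : R) (fun s => form3 (perturb i j k s w) -> O (perturb i j k s w)).
  exact: (c _ ((open_form3P OF).1 Oo w Ow)).
have /nbhs_dnbhs n' : \forall s \near (0 : R), O (perturb i j k s w).
  apply: (@filterS _ (nbhs (0 : R)) (nbhs_filter (0 : R)) _ _ _ n) => s; apply.
  by apply: form3_perturb; exact: OF.
have [s [Os sn]] := @filter_ex _ _ _ _ (filterI n' (nbhs_dnbhs_neq (0 : R))).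
by exists s; rewrite E w0 add0r.
Qed.

Ltac split_hyps := repeat match goal with
  | H : _ /\ _ |- _ => destruct H
  | H : and3 _ _ _ |- _ => destruct H
  | H : and4 _ _ _ _ |- _ => destruct H
  end.

(** The conditions of a stage do not involve the coefficient that is about to become a pivot, so
    they survive its perturbation. *)
Ltac stage_perturb S := move: S; stage_unfold => S; split_hyps; split_all;
  rewrite !coef_perturb //; cbv [wedge_coef kron Nat.eqb];
  rewrite ?(mulr0, mul0r, subrr, subr0, addr0) //.

(** Perturbations and steps alternate: the former stay in [O] because it is open, the latter because
    it is invariant. *)
Lemma open_stage8 (O : set (tensor3 R)) w : O `<=` @form3 R ->
  open (O : set (subspace (@form3 R))) ->
  (forall u v, O u -> eqv u v -> O v) -> O w ->
  exists u, [/\ O u, stage8 u & coef u 3 4 5 != 0].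
Proof.
move=> OF Oo Oe.
have pivot u i j k : O u -> [&& i < 7, j < 7, k < 7, i != j, j != k & i != k]%N ->
    exists s, O (perturb i j k s u) /\ coef (perturb i j k s u) i j k != 0.
  by move=> Ou; apply: open_pivot.
have go l u : O u -> eqv u (run l u) -> O (run l u) by apply: Oe.
move=> M0.
have [s1 [M1 p1]] := pivot _ 0%N 1%N 4%N M0 erefl.
(* The reduced form is hidden behind an existential, so that terms do not grow from stage to
   stage. *)
have : exists u, O u /\ stage1 u.
  by eexists; split; [exact: go M1 (step1_eqv (OF _ M1) p1) | exact: step1P (OF _ M1) p1].
case=> w1 [Q1 S1].
have [s2 [M2 p2]] := pivot _ 0%N 2%N 5%N Q1 erefl.
have {}S1 : stage1 (perturb 0 2 5 s2 w1) by stage_perturb S1.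
have : exists u, O u /\ stage2 u.
  by eexists; split; [exact: go M2 (step2_eqv (OF _ M2) p2) | exact: step2P (OF _ M2) S1 p2].
case=> w2 [Q2 S2].
have [s3 [M3 p3]] := pivot _ 0%N 3%N 6%N Q2 erefl.
have {}S2 : stage2 (perturb 0 3 6 s3 w2) by stage_perturb S2.
have : exists u, O u /\ stage3 u.
  by eexists; split; [exact: go M3 (step3_eqv (OF _ M3) p3) | exact: step3P (OF _ M3) S2 p3].
case=> w3 [Q3 S3].
have : exists u, O u /\ stage4 u.
  eexists; split; last exact: step4P (OF _ Q3) S3.
  by apply: go (Q3) _; apply: run_eqv => //; exact: OF.
case=> w4 [Q4 S4].
have [s5 [M5 p5]] := pivot _ 1%N 2%N 3%N Q4 erefl.
have {}S4 : stage4 (perturb 1 2 3 s5 w4) by stage_perturb S4.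
have : exists u, O u /\ stage5 u.
  eexists; split; last exact: step5P (OF _ M5) S4 p5.
  by apply: go (M5) _; apply: run_eqv => //; exact: OF.
case=> w5 [Q5 S5].
have [s6 [M6 p6]] := pivot _ 1%N 5%N 6%N Q5 erefl.
have {}S5 : stage5 (perturb 1 5 6 s6 w5) by stage_perturb S5.
have : exists u, O u /\ stage6 u.
  eexists; split; last exact: step6P (OF _ M6) S5 p6.
  by apply: go (M6) _; apply: run_eqv => //; exact: OF.
case=> w6 [Q6 S6].
have [s7 [M7 p7]] := pivot _ 2%N 4%N 6%N Q6 erefl.
have {}S6 : stage6 (perturb 2 4 6 s7 w6) by stage_perturb S6.
have : exists u, O u /\ stage7 u.
  eexists; split; last exact: step7P (OF _ M7) S6 p7.
  by apply: go (M7) _; apply: run_eqv => //; exact: OF.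
case=> w7 [Q7 S7].
have : exists u, O u /\ stage8 u.
  eexists; split; last exact: step8P (OF _ Q7) S7.
  by apply: go (Q7) _; apply: run_eqv => //; exact: OF.
case=> w8 [Q8 S8].
have [s9 [M9 p9]] := pivot _ 3%N 4%N 5%N Q8 erefl.
have {}S8 : stage8 (perturb 3 4 5 s9 w8) by stage_perturb S8.
by exists (perturb 3 4 5 s9 w8).
Qed.

End Orbits.

(** * The two representatives and their inequivalence *)

Section Representatives.
Variable R : realType.
Implicit Types w u : tensor3 R.

(** Up to a change of basis, this form and the next are the 3-forms of the split and of the compact
    group G_2. *)
Definition fano_split : tensor3 R := fano 1 1 1 1 1 1 1.
Definition fano_compact : tensor3 R := fano 1 1 1 1 (- 1) (- 1) (- 1).

Lemma stage8_fanoE u : form3 u -> stage8 u ->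
  u = fano 1 1 1 (coef u 1 2 3) (coef u 1 5 6) (- coef u 2 4 6) (coef u 3 4 5).
Proof.
by move=> Fu [v [c1 c2 c3] _]; rewrite {1}(vanish_fano Fu v) c1 c2 c3.
Qed.

Lemma stage8_fano (a t1 t2 t3 : R) : a != 0 -> t1 != 0 -> t2 != 0 ->
  stage8 (fano 1 1 1 a t1 t2 t3).
Proof.
move=> an t1n t2n; have [v [c [c4 c5 c6 _]]] := fano_coefs 1 1 1 a t1 t2 t3.
by rewrite /stage8 c4 c5 c6 oppr_eq0.
Qed.

Lemma near_coef_gt (F : set_system (tensor3 R)) (FF : Filter F)
    (W : tensor3 R -> tensor3 R) w0 i j k : W @ F --> w0 -> 0 < coef w0 i j k ->
  \forall w \near F, 0 < coef (W w) i j k.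
Proof. by move=> W0 p; apply: (@cvgr_gt _ _ F FF _ _ (@cvg_coef _ _ F FF W w0 i j k W0)). Qed.

Lemma near_coef_lt (F : set_system (tensor3 R)) (FF : Filter F)
    (W : tensor3 R -> tensor3 R) w0 i j k : W @ F --> w0 -> coef w0 i j k < 0 ->
  \forall w \near F, coef (W w) i j k < 0.
Proof. by move=> W0 p; apply: (@cvgr_lt _ _ F FF _ _ (@cvg_coef _ _ F FF W w0 i j k W0)). Qed.

(** The reduced form is close to [fano_compact], so its coefficients on 123, 156, 246, 345 keep
    their signs, and these determine its class. *)
Lemma near_compact :
  \forall w \near within (@form3 R) (nbhs fano_compact), eqv fano_compact w.
Proof.
have Fc : form3 fano_compact by apply: form3_fano.
have [] := near_stage8 Fc; first by apply: stage8_fano; rewrite ?oppr_eq0 oner_eq0.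
move=> W W0 n.
set F := within _ _ in W0 n *.
have FF : Filter F by apply: within_filter.
have [_ [_ [c1 c2 c3 c4]]] := fano_coefs 1 1 1 1 (- 1) (- 1) (- 1 : R).
have n1 := @near_coef_gt F FF W _ 1 2 3 W0 (eq_ind_r (fun x => 0 < x) ltr01 c1).
have n2 := @near_coef_lt F FF W _ 1 5 6 W0 (eq_ind_r (fun x => x < 0) (ltrN10 R) c2).
have n3 := @near_coef_gt F FF W _ 2 4 6 W0
  (eq_ind_r (fun x => 0 < x) (eq_ind_r (fun x => 0 < x) ltr01 (opprK _)) c3).
have n4 := @near_coef_lt F FF W _ 3 4 5 W0 (eq_ind_r (fun x => x < 0) (ltrN10 R) c4).
apply: (@filterS _ F FF _ _ _ (@filterI _ F FF _ _ n
  (@filterI _ F FF _ _ (@filterI _ F FF _ _ n1 n2) (@filterI _ F FF _ _ n3 n4)))).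
move=> w [[Fw wW S] [[p1 p2] [p3 p4]]]; apply: eqv_sym; apply: (eqv_trans wW).
rewrite (stage8_fanoE Fw S); apply: compact_fano.
- by rewrite pmulr_rlt0.
- by rewrite pmulr_rlt0 // oppr_lt0.
- by rewrite pmulr_rlt0.
Qed.

Lemma near_split :
  \forall w \near within (@form3 R) (nbhs fano_split), eqv fano_split w.
Proof.
have Fc : form3 fano_split by apply: form3_fano.
have [] := near_stage8 Fc; first by apply: stage8_fano; rewrite oner_eq0.
move=> W W0 n.
set F := within _ _ in W0 n *.
have FF : Filter F by apply: within_filter.
have [_ [_ [c1 c2 c3 c4]]] := fano_coefs 1 1 1 1 1 1 (1 : R).
have n1 := @near_coef_gt F FF W _ 1 2 3 W0 (eq_ind_r (fun x => 0 < x) ltr01 c1).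
have n2 := @near_coef_gt F FF W _ 1 5 6 W0 (eq_ind_r (fun x => 0 < x) ltr01 c2).
have n3 := @near_coef_lt F FF W _ 2 4 6 W0 (eq_ind_r (fun x => x < 0) (ltrN10 R) c3).
have n4 := @near_coef_gt F FF W _ 3 4 5 W0 (eq_ind_r (fun x => 0 < x) ltr01 c4).
apply: (@filterS _ F FF _ _ _ (@filterI _ F FF _ _ n
  (@filterI _ F FF _ _ (@filterI _ F FF _ _ n1 n2) (@filterI _ F FF _ _ n3 n4)))).
move=> w [[Fw wW S] [[p1 p2] [p3 p4]]].
have one : (1 : R) != 0 by apply: oner_neq0.
apply: (@eqv_trans _ _ (Omega0 R)).
  by apply: split_fano => //; rewrite !mulr1.
apply: eqv_sym; apply: (eqv_trans wW).
rewrite (stage8_fanoE Fw S); apply: split_fano => //.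
by rewrite !mulr_gt0 // oppr_gt0.
Qed.

Lemma fano_split_Omega0 : eqv fano_split (Omega0 R).
Proof. by apply: split_fano; rewrite ?oner_neq0 // !mulr1. Qed.

(** [Omega1] for the canonical dual basis, with indices shifted to start at 0. *)
Definition Omega1_std : tensor3 R := fun v =>
  bwedge 0 3 6 v + bwedge 1 4 6 v + bwedge 2 5 6 v + bwedge 0 1 2 v - bwedge 0 4 5 v
  + bwedge 1 3 5 v - bwedge 2 3 4 v.

Lemma form3_Omega1_std : form3 Omega1_std.
Proof. by do 6?apply: form3D; try apply: form3N; apply: form3_wedge3. Qed.

Lemma coef_Omega1_std p q r : [&& p < 7, q < 7 & r < 7]%N ->
  coef Omega1_std p q r =
  wedge_coef R 0 3 6 p q r + wedge_coef R 1 4 6 p q r + wedge_coef R 2 5 6 p q r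
  + wedge_coef R 0 1 2 p q r - wedge_coef R 0 4 5 p q r
  + wedge_coef R 1 3 5 p q r - wedge_coef R 2 3 4 p q r.
Proof. by move=> pqr; rewrite -!coef_bwedge. Qed.

(** In [Omega1_std] the last basis vector plays the role of e_0, so a cyclic shift of the indices
    suffices. *)
Lemma fano_compact_Omega1_std : eqv fano_compact Omega1_std.
Proof.
have Fc : form3 fano_compact by apply: form3_fano.
have [v [[c1 c2 c3] [c4 c5 c6 c7]]] := fano_coefs 1 1 1 1 (- 1) (- 1) (- 1 : R).
apply: (@eqv_monomial _ [:: 1; 2; 3; 4; 5; 6; 0]%N [:: 1; 1; 1; 1; 1; 1; 1]) => //.
- exact: form3_Omega1_std.
- by rewrite /= oner_neq0.
have E p q r : coef fano_compact p q r = coef_sorted zeros8 fano_compact p q r.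
  by rewrite (coef_sortedE _ _ _ Fc v).
cbv [triples foldr fst snd nth]; split_all; rewrite E coef_Omega1_std //;
cbv [wedge_coef kron coef_sorted coef_or0 mem3 Nat.eqb Nat.ltb Nat.leb foldr fst snd
  zeros1 zeros2 zeros5 zeros6 zeros7 zeros8 orb andb cat];
rewrite ?c1 ?c2 ?c3 ?c4 ?c5 ?c6 ?c7; ring.
Qed.

(** The rows of [M] are the covectors of [e], so [M] pulls the coordinates back to [e]. A relation
    between its rows is one between these covectors, whose freeness makes [M] invertible. *)
Lemma Omega1_std_eqv (e : 7.-tuple (covec7 R)) : basis_of fullv e ->
  eqv Omega1_std (Omega1 e).
Proof.
move=> he; pose M : 'M[R]_7 := \matrix_(i, j) (e`_i : covec7 R) (delta_mx j 0).
have ME i X : (i < 7)%N -> (e`_i : covec7 R) X = coord7 R (inord i) (M *m X).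
  move=> i7; rewrite coord7E mxE {1}(vec7E X) linear_sum /=; apply: eq_bigr => j _.
  by rewrite linearZ /= mxE inordK // /bvec inord_val mulrC.
have MU : M \in unitmx.
  rewrite -row_free_unit; apply: inj_row_free => u uM.
  have /freeP fe := basis_free he.
  apply/rowP => i; rewrite mxE; apply: fe.
  apply/lfunP => X; rewrite sum_lfunE lfunE /=.
  transitivity ((u *m M *m X) 0 0); last by rewrite uM mul0mx mxE.
  rewrite -mulmxA mxE; apply: eq_bigr => j _.
  by rewrite scale_lfunE ME // coord7E inord_val.
exists M => //; apply/funext => -[[X Y] Z].
rewrite /pull /Omega1 /Omega1_std /basis_wedge /bwedge !wedge3E.
by rewrite !ME.
Qed.

Lemma form3_Omega1 (e : 7.-tuple (covec7 R)) : form3 (Omega1 e).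
Proof.
by do 6?apply: form3D; try apply: form3N; apply: form3_wedge3.
Qed.

(** No term of [Omega0] contains both indices 1 and 5. *)
Lemma Omega0_kernel Z : Omega0 R (bvec R 1, bvec R 5, Z) = 0.
Proof.
rewrite Omega0E /bwedge !wedge3E !coord7E !mxE !inord_eq //=.
by rewrite !(mulr0, mul0r, subr0, addr0, mulr1).
Qed.

Lemma sum7E (f : 'I_7 -> R) : \sum_i f i = f (inord 0) + f (inord 1) + f (inord 2)
  + f (inord 3) + f (inord 4) + f (inord 5) + f (inord 6).
Proof.
rewrite !big_ord_recr big_ord0 /= add0r.
by congr (_ + _ + _ + _ + _ + _ + _); congr f; apply/val_inj; rewrite /= inordK.
Qed.

Lemma bwedgeE i j k (X Y Z : vec7 R) (x := fun n => X (inord n) 0)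
    (y := fun n => Y (inord n) 0) (z := fun n => Z (inord n) 0) :
  bwedge i j k (X, Y, Z) = x i * (y j * z k - z j * y k) - y i * (x j * z k - z j * x k)
    + z i * (x j * y k - y j * x k) :> R.
Proof. by rewrite /bwedge wedge3E !coord7E. Qed.

Lemma bvec_coord m n : (m < 7)%N -> (n < 7)%N -> bvec R m (inord n) 0 = kron R m n.
Proof.
by move=> m7 n7; rewrite mxE eqxx andbT inord_eq // eq_sym /kron NateqbE; case: eqP.
Qed.

(* Lagrange's identity for the cross product of R^7. *)
Lemma fano_compact_kernel (X Y : vec7 R) :
  (forall Z, fano_compact (X, Y, Z) = 0) ->
  (\sum_i Y i 0 ^+ 2) *: X = (\sum_i X i 0 * Y i 0) *: Y.
Proof.
move=> h; set YY := (X in X *: _ = _); set XY := (X in _ = X *: _).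
(* [z] is |Y|^2 times the part of X orthogonal to Y when Y is nonzero. Its squared norm is |Y|^2
   (|X|^2 |Y|^2 - <X,Y>^2), whose second factor is the squared norm of the cross product, here 0. *)
pose z := YY *: X - XY *: Y.
suff z0 : \sum_i z i 0 ^+ 2 = 0.
  apply/eqP; rewrite -subr_eq0; apply/eqP/colP => i.
  have /psumr_eq0P : \sum_i z i 0 ^+ 2 = 0 by [].
  move=> /(_ (fun i _ => sqr_ge0 _)) /(_ i isT) /eqP.
  by rewrite sqrf_eq0 => /eqP; rewrite /z !mxE.
have lagrange : (\sum_i X i 0 ^+ 2) * YY - XY ^+ 2
    = \sum_(m < 7) fano_compact (X, Y, bvec R m) ^+ 2.
  have bwedge_bvec i j k m : (m < 7)%N -> [&& i < 7, j < 7 & k < 7]%N ->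
      bwedge i j k (X, Y, bvec R m)
      = X (inord i) 0 * (Y (inord j) 0 * kron R m k - kron R m j * Y (inord k) 0)
        - Y (inord i) 0 * (X (inord j) 0 * kron R m k - kron R m j * X (inord k) 0)
        + kron R m i * (X (inord j) 0 * Y (inord k) 0 - Y (inord j) 0 * X (inord k) 0).
    by move=> m7 /and3P [i7 j7 k7]; rewrite bwedgeE !bvec_coord.
  rewrite /YY /XY !sum7E !inordK // /fano_compact /fano !bwedge_bvec //.
  cbv [kron Nat.eqb].
  move: (X (inord 0) 0) (X (inord 1) 0) (X (inord 2) 0) (X (inord 3) 0)
    (X (inord 4) 0) (X (inord 5) 0) (X (inord 6) 0) => x0 x1 x2 x3 x4 x5 x6.
  move: (Y (inord 0) 0) (Y (inord 1) 0) (Y (inord 2) 0) (Y (inord 3) 0)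
    (Y (inord 4) 0) (Y (inord 5) 0) (Y (inord 6) 0) => y0 y1 y2 y3 y4 y5 y6.
  ring.
transitivity (YY * ((\sum_i X i 0 ^+ 2) * YY - XY ^+ 2)); last first.
  by rewrite lagrange big1 ?mulr0 // => m _; rewrite h expr0n.
under eq_bigr do rewrite !mxE.
rewrite /XY /YY !sum7E; ring.
Qed.

(** An equivalence g would send e_1, e_5 to a pair annihilated by [fano_compact]. Then |g e_5|^2 e_1
    is a multiple of e_5, so g e_5 = 0, against invertibility. *)
Lemma fano_compact_not_Omega0 : ~ eqv fano_compact (Omega0 R).
Proof.
case=> g gU E.
have h0 Z : fano_compact (g *m bvec R 1, g *m bvec R 5, Z) = 0.
  by rewrite -(Omega0_kernel (invmx g *m Z)) E /pull mulKVmx.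
have := fano_compact_kernel h0.
set y2 := \sum_i _; set xy := \sum_i _ => /(congr1 (mulmx (invmx g))).
rewrite -!scalemxAr !mulKmx // => e15.
have y20 : y2 = 0.
  have /matrixP /(_ (inord 1) 0) := e15.
  by rewrite !mxE eqxx !inord_eq //= mulr1 mulr0.
have /psumr_eq0P : \sum_i (g *m bvec R 5) i 0 ^+ 2 = 0 by [].
move=> /(_ (fun i _ => sqr_ge0 _)) h.
have g5 : g *m bvec R 5 = 0.
  by apply/colP => i; have /eqP := h i isT; rewrite sqrf_eq0 [in RHS]mxE => /eqP.
have : bvec R 5 = 0 by rewrite -(mulKmx gU (bvec R 5)) g5 mulmx0.
move=> /matrixP /(_ (inord 5) 0); rewrite !mxE !eqxx => /eqP.
by rewrite oner_eq0.
Qed.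

End Representatives.

Theorem theorem4p9 (R : realType) (e : 7.-tuple (covec7 R))
    (he : basis_of fullv e) :
  [/\ generic (Omega0 R),
      generic (Omega1 e),
      orbit3 (Omega0 R) <> orbit3 (Omega1 e) &
      [set orbit3 w | w in @generic R]
        = [set orbit3 (Omega0 R); orbit3 (Omega1 e)]].
Proof.
have F0 := form3_Omega0 R; have F1 := form3_Omega1 e.
have e0 := fano_split_Omega0 R.
have e1 := eqv_trans (fano_compact_Omega1_std R) (Omega1_std_eqv he).
have g0 : generic (Omega0 R).
  split=> //; rewrite -(orbit3_eq e0); apply: open_orbit3 (near_split R).
  exact: form3_fano.
have g1 : generic (Omega1 e).
  split=> //; rewrite -(orbit3_eq e1); apply: open_orbit3 (near_compact R).
  exact: form3_fano.
split=> //.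
  move=> e01; apply: (@fano_compact_not_Omega0 R); apply: (eqv_trans e1).
  by apply/orbit3P; rewrite -e01; apply/orbit3P; apply: eqv_refl.
apply/seteqP; split=> [_ [w [Fw Ow] <-]|_ [->|->]]; last 2 first.
- by exists (Omega0 R).
- by exists (Omega1 e).
(* An open orbit contains a Fano form with seven nonzero coefficients, and the classification places
   it in one of the two orbits. *)
have [u [/orbit3P wu Su tu]] : exists u, [/\ orbit3 w u, stage8 u & coef u 3 4 5 != 0].
  apply: open_stage8 (orbit3_sub_form3 Fw) Ow _ _.
    by move=> u v /orbit3P wu uv; apply/orbit3P; apply: eqv_trans uv.
  by apply/orbit3P; apply: eqv_refl.
have Fu := eqv_form3 wu Fw; rewrite (orbit3_eq wu).
have [_ _ [an t1n t2n]] := Su.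
have := @fano_classification R (coef u 1 2 3) (coef u 1 5 6) (- coef u 2 4 6)
  (coef u 3 4 5) an t1n.
rewrite oppr_eq0 -(stage8_fanoE Fu Su) => /(_ t2n tu) [uO|uO]; [left|right].
  exact: orbit3_eq uO.
by apply: orbit3_eq; apply: eqv_trans e1.
Qed.
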